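(* Let $(M,\tau)$ be a finite von Neumann algebra with a faithful normal tracial state. If $\{x_1,\ldots,x_n\} \subset M$ is L-free with $\|x_i\|\leq 1$ for all $i$, then $$\Bigl\|\sum_{i=1}^n x_i\Bigr\| \leq 2\sqrt{n-1}.$$ More generally, given any complex scalars $\alpha_1,\ldots,\alpha_n$ with $\sum_{i=1}^n|\alpha_i|^2\leq 1$, we have $$\Bigl\|\sum_{i=1}^n\alpha_i x_i\Bigr\| \leq 2\sqrt{1-1/n}.$$
   Context: Let $(M,\tau)$ be a von Neumann algebra with a normal faithful tracial state. A subset $X\subset M$ is called L-free if $$\tau(x_1x_2^*\cdots x_{2k-1}x_{2k}^* ) = 0 \quad\text{and}\quad \tau(x_1^*x_2\cdots x_{2k-1}^*x_{2k}) = 0$$ whenever $k\geq 1$, $x_1,\ldots,x_{2k}\in X$ and $x_i\neq x_{i+1}$ for all $i = 1,\ldots,2k-1$. The norm $\|\cdot\|$ is the operator norm.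
   Formalization: The formal theorem assumes n ≥ 2 and that x_1,…,x_n are pairwise distinct: for n = 1 the set {1} is vacuously L-free but has norm 1 > 0, and three copies of 1 violate the bound 2√2. *)

(* Defs.v *)
From HB Require Import structures.
From mathcomp Require Import all_boot all_order all_algebra.
From mathcomp Require Import complex.
From mathcomp Require Import all_classical all_reals all_analysis.

Set Implicit Arguments.
Unset Strict Implicit.
Unset Printing Implicit Defensive.

Import Order.TTheory GRing.Theory Num.Theory.
Import numFieldNormedType.Exports.

Local Open Scope classical_set_scope.
Local Open Scope ring_scope.

Section HilbertSpace.
Variables (R : realType) (H : completeNormedModType R[i]).

(* The complete norm of H is the one induced by the inner product [dot], which
   is linear in its first argument: (H, dot) is a complex Hilbert space. *)
Definition hilbert_dot (dot : {dot H for Num.conj}) : Prop :=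
  forall u : H, `|u| ^+ 2 = dot u u.

Definition bounded_operator (T : H -> H) : Prop := linear T /\ continuous T.

(* [`|u|] lies in R[i], with zero imaginary part; the norm of an operator is
   taken in R. *)
Definition opnorm (T : H -> H) : R :=
  sup [set complex.Re `|T u| | u in [set u : H | `|u| <= 1]].

Definition commutant (M : set (H -> H)) : set (H -> H) :=
  [set S | bounded_operator S /\ forall T, M T -> S \o T = T \o S].

Variable dot : {dot H for Num.conj}.

Definition adjoint_of (T S : H -> H) : Prop :=
  forall u v : H, dot (T u) v = dot u (S v).

(* T^*, unique when it exists (see [adjE]); it exists for T bounded. *)
Definition adj (T : H -> H) : H -> H := xget (fun=> 0) (adjoint_of T).

Lemma adjE (T S : H -> H) : adjoint_of T S -> adj T = S.
Proof.
move=> TS; apply: xget_unique => // S' TS'; apply/funext => v.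
apply/eqP; rewrite -subr_eq0; apply/negPn/negP => ne0.
have := @neq0_dnorm_gt0 _ _ _ dot _ ne0.
have -> : dot (S' v - S v) (S' v - S v)
    = dot (S' v - S v) (S' v) - dot (S' v - S v) (S v) by rewrite linearBr.
by rewrite -TS -TS' subrr ltxx.
Qed.

(* A self-adjoint set of bounded operators equal to its bicommutant; it is then
   a unital *-subalgebra of B(H). *)
Definition von_neumann_algebra (M : set (H -> H)) : Prop :=
  [/\ M `<=` bounded_operator,
      forall T, M T -> exists2 S, M S & adjoint_of T S
    & commutant (commutant M) = M].

(* Every isometry of M is a unitary. *)
Definition finite_algebra (M : set (H -> H)) : Prop :=
  forall V, M V -> adj V \o V = idfun -> V \o adj V = idfun.

(* [0 <= z] in R[i] means that z is real and nonnegative. *)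
Definition op_le (S T : H -> H) : Prop :=
  forall u : H, 0 <= dot (T u - S u) u.

Definition directed (D : set (H -> H)) : Prop :=
  D !=set0 /\
  forall S T, D S -> D T -> exists2 U, D U & op_le S U /\ op_le T U.

Definition least_upper_bound (M D : set (H -> H)) (S : H -> H) : Prop :=
  [/\ M S, forall T, D T -> op_le T S
    & forall U, M U -> (forall T, D T -> op_le T U) -> op_le S U].

(* Only the values of [tau] on M matter below. *)
Definition tracial_state (M : set (H -> H)) (tau : (H -> H) -> R[i]) : Prop :=
  [/\ forall (a : R[i]) S T, M S -> M T -> tau (a *: S + T) = a * tau S + tau T,
      forall T, M T -> 0 <= tau (adj T \o T),
      tau idfun = 1
    & forall S T, M S -> M T -> tau (S \o T) = tau (T \o S)].

Definition faithful (M : set (H -> H)) (tau : (H -> H) -> R[i]) : Prop :=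
  forall T, M T -> tau (adj T \o T) = 0 -> T = 0.

(* tau (sup S_i) = sup tau (S_i) for increasing bounded nets (S_i) in M_+: [D]
   is the range of the net and [S] its supremum. *)
Definition normal (M : set (H -> H)) (tau : (H -> H) -> R[i]) : Prop :=
  forall (D : set (H -> H)) (S : H -> H),
    D `<=` M -> (forall T, D T -> op_le 0 T) -> directed D ->
    least_upper_bound M D S ->
    complex.Re (tau S) = sup [set complex.Re (tau T) | T in D].

(* The family (x_1, ..., x_2k) is indexed from 0. *)
Definition L_free (tau : (H -> H) -> R[i]) (X : set (H -> H)) : Prop :=
  forall (k : nat) (x : nat -> H -> H), (1 <= k)%N ->
    (forall i, (i < 2 * k)%N -> X (x i)) ->
    (forall i, (i.+1 < 2 * k)%N -> x i <> x i.+1) ->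
    tau (\big[comp/idfun]_(j < k) (x (2 * j)%N \o adj (x (2 * j).+1))) = 0 /\
    tau (\big[comp/idfun]_(j < k) (adj (x (2 * j)%N) \o x (2 * j).+1)) = 0.

End HilbertSpace.

(* Main.v *)
Require Import Defs.
From HB Require Import structures.
From mathcomp Require Import all_boot all_order all_algebra.
From mathcomp Require Import complex.
From mathcomp Require Import ring lra zify.
From mathcomp Require Import all_classical all_reals all_analysis.

Import Order.TTheory GRing.Theory Num.Theory.
Import numFieldNormedType.Exports.

Set Implicit Arguments.
Unset Strict Implicit.
Unset Printing Implicit Defensive.

Local Open Scope classical_set_scope.
Local Open Scope ring_scope.

(** Write h = sum_i alpha_i x_i.  By faithfulness it is enough to prove
    tau(b^* (z^2 - h^* h) b) >= 0 for every b in M, where z = 2 sqrt(1 - 1/n).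
    Indeed y = z^2 - h^* h has an absolute value Y = sqrt(y^2) in M, and testing
    with b = Y - y kills b, so that y = Y >= 0 ([nbound_of_trace]).  The square
    roots come from an explicit norm-convergent iteration ([sqrt_one_sub]).

    If the x_i were unitaries, the words in the x_i and x_i^* would reduce as in
    a free product of n copies of Z/2, L-freeness would give all traces, and the
    bound would be the norm of a weighted walk on the n-regular tree.  Words in
    contractions do not reduce, and L-freeness says nothing about the traces of
    words with equal neighbours.  So the x_i are replaced by symmetries, at the
    level of Gram matrices.  Let [gram b g h] be the inner product, for tau, of
    the alternating products W_g b and W_h b, or 0 if the lengths of g and h have
    different parities.  Define [tree_kernel (gram b) g h] by first deleting the
    longest common prefix of g and h.  Then

    - the letters act as symmetries for this kernel on reduced words
      ([tree_kernel_step]);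
    - it dominates [gram b], because the x_i are contractions
      ([tree_kernel_ge]); in particular it is positive.

    Let a_m be the m-th moment, at b, of the sum with weights beta_i = |alpha_i|
    of these symmetries.  Positivity gives a_m^2 <= a_0 a_2m, so that growth
    a_2m = O(z^2m) already forces a_2 <= z^2 a_0 ([quadratic_growth]); and
    a_0 = tau(b^* b), while a_2 >= tau((h b)^* (h b)) by domination.

    It remains to bound the growth.  For b = 1, L-freeness makes the first
    column of the kernel a delta at the empty word, so that a_m is a weighted
    count of closed walks on the tree.  It is at most z^m because a
    multiplicative function phi(g) = prod r_i satisfies walk phi <= z phi
    ([walk_weight]), for weights r_i chosen in [optimal_weights].  For a general
    b, pick K and d with b b^* + d d^* = K.  As the first column depends linearly
    on b b^*, the moments at b and d add up to K times those at 1, and those at d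
    of even order are nonnegative.  This is [Lfree_L2_bound].  The bound on
    sum_i x_i is the one for alpha_i = 1/sqrt n, rescaled. *)

(** * Reduced words, weighted walks and the kernel of the dilation *)
Section Words.
Variable (I : finType).

Definition reduced (g : seq I) : bool := sorted (fun i j => i != j) g.

(** Left multiplication by a generator in the free product of copies of Z/2,
    whose elements are the reduced words. *)
Definition step (i : I) (g : seq I) : seq I :=
  if g is j :: g' then if i == j then g' else i :: g else [:: i].

Lemma reduced_step i g : reduced g -> reduced (step i g).
Proof.
case: g => [|j g] //=; rewrite /reduced /=.
case: eqVneq => [_ /path_sorted //|ij /=]; by rewrite ij.
Qed.

Variable R : realFieldType.

Section Walk.
Variable beta : I -> R.

Definition walk (F : seq I -> R) (g : seq I) : R :=
  \sum_i beta i * F (step i g).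

Lemma iter_walk_ext m (F F' : seq I -> R) :
    (forall g, reduced g -> F g = F' g) ->
  forall g, reduced g -> iter m walk F g = iter m walk F' g.
Proof.
move=> FF'; elim: m => //= m IHm g rg; apply: eq_bigr => i _.
by rewrite IHm // reduced_step.
Qed.

Lemma iter_walk_lin m (c c' : R) (F F' : seq I -> R) g :
  iter m walk (fun w => c * F w + c' * F' w) g =
  c * iter m walk F g + c' * iter m walk F' g.
Proof.
elim: m g => //= m IHm g; rewrite /walk !mulr_sumr -big_split /=.
by apply: eq_bigr => i _; rewrite IHm; ring.
Qed.

Lemma iter_walk_le m (F F' : seq I -> R) : (forall i, 0 <= beta i) ->
    (forall g, reduced g -> F g <= F' g) ->
  forall g, reduced g -> iter m walk F g <= iter m walk F' g.
Proof.
move=> b0 FF'; elim: m => //= m IHm g rg; apply: ler_sum => i _.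
by rewrite ler_wpM2l // IHm // reduced_step.
Qed.

(** The finite form of the walk: it turns statements about iterates into
    statements about the Gram matrix of a finite family of weighted words. *)
Lemma iter_walk_expand m g : reduced g ->
  exists2 s : seq (R * seq I), {in s, forall p, reduced p.2} &
    forall F : seq I -> R, iter m walk F g = \sum_(p <- s) p.1 * F p.2.
Proof.
elim: m g => [|m IHm] g rg.
  exists [:: (1, g)] => [p|F]; first by rewrite inE => /eqP ->.
  by rewrite big_seq1 mul1r.
have /fin_all_exists2[s sr sE] i := IHm (step i g) (reduced_step i rg).
exists (flatten [seq [seq (beta i * p.1, p.2) | p <- s i] | i : I]) => [p|F].
  by case/flatten_mapP => i _ /mapP[q qs ->]; exact: sr qs.
rewrite big_flatten big_map /= big_enum; apply: eq_bigr => i _.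
by rewrite sE big_map mulr_sumr; apply: eq_bigr => p _; rewrite mulrA.
Qed.

(** A positive supersolution bounds all iterates, hence all weighted counts of
    closed walks, without counting them. *)
Lemma iter_walk_supersolution m z (phi : seq I -> R) :
    (forall i, 0 <= beta i) -> 0 <= z ->
    (forall g, reduced g -> walk phi g <= z * phi g) ->
  forall g, reduced g -> iter m walk phi g <= z ^+ m * phi g.
Proof.
move=> b0 z0 phiz; elim: m => [|m IHm] g rg; first by rewrite mul1r.
rewrite iterSr.
have := iter_walk_le m b0 phiz rg => /le_trans; apply.
have := iter_walk_lin m z 0 phi phi g.
rewrite (@iter_walk_ext m _ (fun w => z * phi w)) => [->|w _|//]; last by ring.
by rewrite mul0r addr0 exprS -mulrA ler_wpM2l ?IHm.
Qed.

End Walk.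

Section Kernel.
Variable G : seq I -> seq I -> R.

(** If G is the Gram kernel of vectors W_g v, where W_g is a product of
    self-adjoint contractions, this is the Gram kernel of the vectors U_g v,
    where U_g is the product of symmetries U_i dilating these contractions, such
    that alternating products of the U_i dilate those of the contractions: the
    common prefix cancels, and the rest is an alternating product. *)
Fixpoint tree_kernel (g h : seq I) : R :=
  match g, h with
  | i :: g', j :: h' => if i == j then tree_kernel g' h' else G g h
  | _, _ => G g h
  end.

(** Self-adjointness of the letters. *)
Hypothesis G_sym : forall i g h, G g (i :: h) = G (i :: g) h.

Lemma tree_kernel_nil g : tree_kernel g [::] = G g [::]. Proof. by case: g. Qed.

Lemma tree_kernel_ohead g h : ohead g != ohead h -> tree_kernel g h = G g h.
Proof.
by case: g h => [|i g] [|j h] //= /negPf; rewrite (inj_eq Some_inj) => ->.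
Qed.

Lemma ohead_reduced i g : reduced (i :: g) -> ohead g != Some i.
Proof.
by case: g => [|j g] //= /andP[ij _]; rewrite (inj_eq Some_inj) eq_sym.
Qed.

Lemma step_reduced i g : ohead g != Some i -> step i g = i :: g.
Proof.
by case: g => [|j g] //=; rewrite (inj_eq Some_inj) eq_sym => /negPf ->.
Qed.

Lemma step_cons i g : step i (i :: g) = g.
Proof. by rewrite /= eqxx. Qed.

Lemma ohead_Some (i : I) g : ohead g = Some i -> g = i :: behead g.
Proof. by case: g => [|j g] //= [->]. Qed.

(** The letters are self-adjoint involutions for the kernel.  If i is the head
    of exactly one word, it cancels on one side and joins the common prefix on
    the other; otherwise no prefix is common and [G_sym] applies. *)
Lemma tree_kernel_step i g h : reduced g -> reduced h ->
  tree_kernel (step i g) h = tree_kernel g (step i h).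
Proof.
move=> rg rh; have [/ohead_Some gE|gi] := eqVneq (ohead g) (Some i);
  have [/ohead_Some hE|hi] := eqVneq (ohead h) (Some i).
- move: rg rh; rewrite gE hE => /ohead_reduced gi /ohead_reduced hi.
  rewrite !step_cons !tree_kernel_ohead //=; last by rewrite eq_sym.
- by rewrite gE step_cons (step_reduced hi) /= eqxx.
- by rewrite hE step_cons (step_reduced gi) /= eqxx.
- rewrite !step_reduced // !tree_kernel_ohead //=; first by rewrite eq_sym.
Qed.

Lemma iter_walk_tree_kernel beta m g h : reduced g -> reduced h ->
  iter m (walk beta) (tree_kernel^~ h) g = iter m (walk beta) (tree_kernel g) h.
Proof.
elim: m g => //= m IHm g rg rh; rewrite {1}/walk.
under eq_bigr => i _ do rewrite IHm ?reduced_step //.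
transitivity (iter m (walk beta) (walk beta (tree_kernel g)) h); last first.
  by rewrite -iterSr.
have -> : iter m (walk beta) (walk beta (tree_kernel g)) h
    = iter m (walk beta) (fun w => \sum_i beta i * tree_kernel (step i g) w) h.
  apply: iter_walk_ext => // w rw; apply: eq_bigr => i _.
  by rewrite tree_kernel_step.
have [s _ sE] := iter_walk_expand beta m rh.
rewrite sE; under [RHS]eq_bigr => p _ do rewrite mulr_sumr.
rewrite exchange_big /=; apply: eq_bigr => i _; rewrite sE mulr_sumr.
by apply: eq_bigr => p _; ring.
Qed.

(** Contractivity of the letters, tested on finite combinations. *)
Hypothesis G_contr : forall i (s : seq (R * seq I)),
  0 <= \sum_(p <- s) \sum_(q <- s)
         p.1 * q.1 * (G p.2 q.2 - G (i :: p.2) (i :: q.2)).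

(** The difference of the two kernels lives on pairs of words with the same head
    i, where it is the same difference for the tails, plus the defect of
    contractivity of the letter i.  Induction on the length of the words. *)
Lemma tree_kernel_ge (s : seq (R * seq I)) :
  \sum_(p <- s) \sum_(q <- s) p.1 * q.1 * G p.2 q.2 <=
  \sum_(p <- s) \sum_(q <- s) p.1 * q.1 * tree_kernel p.2 q.2.
Proof.
rewrite -subr_ge0 -sumrB; under eq_bigr => p _ do rewrite -sumrB.
have [N] : exists N, all (fun p => size p.2 <= N)%N s.
  exists (\max_(p <- s) size p.2); apply/allP => p ps.
  by rewrite (big_rem p) //= leq_maxl.
elim: N s => [|N IHN] s sN.
  rewrite big_seq big1 // => p ps; rewrite big_seq big1 // => q qs.
  move/allP: sN => /(_ _ ps); case: (p.2) => // _.
  by rewrite /= subrr.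
pose t i := [seq (p.1, behead p.2) | p <- s & ohead p.2 == Some i].
pose e (p q : R * seq I) :=
  p.1 * q.1 * tree_kernel p.2 q.2 - p.1 * q.1 * G p.2 q.2.
have -> : \sum_(p <- s) \sum_(q <- s) e p q =
    \sum_i \sum_(p <- t i) \sum_(q <- t i)
      p.1 * q.1 * (tree_kernel p.2 q.2 - G (i :: p.2) (i :: q.2)).
  transitivity (\sum_(p <- s) \sum_(i | ohead p.2 == Some i)
      \sum_(q <- s | ohead q.2 == Some i) e p q).
    apply: eq_bigr => p _; case pE: (p.2) => [|i g] /=.
      rewrite [RHS]big_pred0 // big1 // => q _.
      by rewrite /e pE /= subrr.
    rewrite (big_pred1 i) => [|j]; last by rewrite (inj_eq Some_inj) eq_sym.
    rewrite [RHS]big_mkcond; apply: eq_bigr => q _.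
    case: ifP => // qi; rewrite /e pE (@tree_kernel_ohead (i :: g)) ?subrr //=.
    by rewrite eq_sym qi.
  rewrite (exchange_big_dep predT) //=; apply: eq_bigr => i _.
  rewrite /t big_map big_filter; apply: eq_bigr => p /eqP/ohead_Some pi.
  rewrite big_map big_filter; apply: eq_bigr => q /eqP/ohead_Some qi.
  by rewrite /e pi qi /= eqxx mulrBr.
apply: sumr_ge0 => i _.
have tN : all (fun p => size p.2 <= N)%N (t i).
  apply/allP => _ /mapP[p + ->]; rewrite mem_filter => /andP[/eqP pi ps].
  by move/allP: sN => /(_ _ ps); rewrite /= size_behead; case: (p.2) pi.
have := addr_ge0 (IHN _ tN) (G_contr i (t i)).
rewrite -big_split /=; under eq_bigr => p _ do rewrite -big_split /=.
congr (_ <= _); apply: eq_bigr => p _; apply: eq_bigr => q _; ring.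
Qed.

Variable beta : I -> R.

(** The m-th moment, at the empty word, of the weighted sum of the dilating
    symmetries; the first column of the tree kernel is that of G. *)
Definition moment m := iter m (walk beta) (G^~ [::]) [::].

Lemma momentE m : moment m = iter m (walk beta) (tree_kernel^~ [::]) [::].
Proof. by apply: iter_walk_ext => // g _; rewrite tree_kernel_nil. Qed.

Hypothesis G_psd : forall s : seq (R * seq I),
  0 <= \sum_(p <- s) \sum_(q <- s) p.1 * q.1 * G p.2 q.2.

(** The square of the norm of (h^m + t) v, where h is the weighted sum of the
    dilating symmetries. *)
Lemma moment_quadratic m t :
  0 <= moment (m + m) + 2 * t * moment m + t ^+ 2 * moment 0.
Proof.
have [s rs sE] := iter_walk_expand beta m (isT : reduced [::]).
have := le_trans (G_psd ((t, [::]) :: s)) (tree_kernel_ge _).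
congr (_ <= _).
have colE h : reduced h ->
    \sum_(q <- s) q.1 * tree_kernel h q.2 =
    iter m (walk beta) (tree_kernel^~ [::]) h.
  by move=> rh; rewrite iter_walk_tree_kernel // sE.
have rowE : \sum_(p <- s) p.1 * tree_kernel p.2 [::] = moment m.
  by rewrite momentE sE.
rewrite big_cons big_cons /=.
have -> : \sum_(q <- s) t * q.1 * tree_kernel [::] q.2 = t * moment m.
  by rewrite momentE -colE // mulr_sumr; apply: eq_bigr => q _; rewrite mulrA.
under eq_bigr => p _ do rewrite big_cons /=.
rewrite big_split /=.
have -> : \sum_(p <- s) p.1 * t * tree_kernel p.2 [::] = t * moment m.
  by rewrite -rowE mulr_sumr; apply: eq_bigr => q _; ring.
have -> : \sum_(p <- s) \sum_(q <- s) p.1 * q.1 * tree_kernel p.2 q.2 =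
    moment (m + m).
  rewrite momentE iterD sE big_seq [RHS]big_seq; apply: eq_bigr => p ps.
  by rewrite -colE ?rs // mulr_sumr; apply: eq_bigr => q _; rewrite mulrA.
by rewrite /moment /=; ring.
Qed.

Lemma moment_even_ge0 m : 0 <= moment (m + m).
Proof.
by have := moment_quadratic m 0; rewrite mulr0 mul0r expr0n /= mul0r !addr0.
Qed.

(** A sum of contractions is dominated by the sum of their dilations. *)
Lemma moment2_ge :
  \sum_i \sum_j beta i * beta j * G [:: i] [:: j] <= moment 2.
Proof.
have := tree_kernel_ge [seq (beta i, [:: i]) | i <- index_enum I].
rewrite !big_map; under eq_bigr => i _ do rewrite big_map /=.
move=> /le_trans; apply; rewrite momentE /walk /=.
rewrite le_eqVlt; apply/orP; left; apply/eqP; apply: eq_bigr => i _.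
rewrite big_map /= mulr_sumr; apply: eq_bigr => j _.
rewrite -mulrA; congr (_ * (_ * _)).
exact/esym/(@tree_kernel_step j [:: i] [::]).
Qed.

End Kernel.

End Words.

(** * Moment growth and supersolutions *)

(** The hypothesis says that a_m^2 <= a_0 a_2m.  If a_0 > 0, the roots
    (a_m / a_0)^(1/m) therefore increase along m = 2^k, and the first of them is
    at most their limit, which is at most z.  If a_0 = 0, then a_2 <= 0. *)
Lemma quadratic_growth (R : archiRealFieldType) (a : nat -> R) (K z : R) :
    0 < z ->
    (forall m t, 0 <= a (m + m)%N + 2 * t * a m + t ^+ 2 * a 0) ->
    (forall m, a (m + m)%N <= K * z ^+ (m + m)) ->
  a 2 <= z ^+ 2 * a 0.
Proof.
move=> z0 aq aK.
have a0 : 0 <= a 0.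
  by have := aq 0 0; rewrite mulr0 mul0r expr0n /= mul0r addn0 !addr0.
rewrite leNgt; apply/negP => a2.
have [a00|a0N] := ltrP 0 (a 0); last first.
  have a00 : a 0 = 0 by apply/eqP; rewrite eq_le a0N.
  rewrite a00 mulr0 in a2; have := aq 2 (- (a 4 + 1) / (2 * a 2)).
  rewrite a00 mulr0 addr0.
  have -> : 2 * (- (a 4 + 1) / (2 * a 2)) * a 2 = - (a 4 + 1).
    by field; lra.
  by rewrite [(2 + 2)%N]/=; lra.
pose rho := a 2 / a 0.
have rho0 : z ^+ 2 < rho by rewrite ltr_pdivlMr.
have growth k : rho ^+ (2 ^ k) * a 0 <= a (2 ^ k.+1)%N.
  elim: k => [|k IHk]; first by rewrite /rho expr1 divfK // gt_eqF.
  have := aq (2 ^ k.+1)%N (- a (2 ^ k.+1)%N / a 0).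
  have -> : (2 ^ k.+1 + 2 ^ k.+1 = 2 ^ k.+2)%N by rewrite addnn -mul2n -expnS.
  set x := a (2 ^ k.+1)%N; set y := a (2 ^ k.+2)%N.
  have -> : y + 2 * (- x / a 0) * x + (- x / a 0) ^+ 2 * a 0 = y - x ^+ 2 / a 0.
    by field; lra.
  rewrite subr_ge0; apply: le_trans.
  rewrite ler_pdivlMr // expnSr exprM -mulrA -expr2 -exprMn.
  by rewrite lerXn2r // nnegrE ?(le_trans _ IHk) // mulr_ge0 ?exprn_ge0 //
    ?ltW //; apply: lt_trans rho0; rewrite exprn_gt0.
pose d := rho / z ^+ 2 - 1.
have z2 : 0 < z ^+ 2 by rewrite exprn_gt0.
have d0 : 0 < d by rewrite subr_gt0 ltr_pdivlMr // mul1r.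
have bern N : 1 + N%:R * d <= (1 + d) ^+ N.
  elim: N => [|N IHN]; first by rewrite mul0r addr0.
  rewrite exprS (le_trans _ (ler_wpM2l _ IHN)) //; last by lra.
  have N0 : 0 <= N%:R :> R by [].
  by rewrite -natr1; nra.
have bnd k : 1 + k%:R * d <= K / a 0.
  have kk : (k <= 2 ^ k)%N by rewrite ltnW // ltn_expl.
  have : rho ^+ (2 ^ k) * a 0 <= K * (z ^+ 2) ^+ (2 ^ k).
    apply: le_trans (growth k) _; rewrite -exprM -expnS.
    have -> : (2 ^ k.+1 = 2 ^ k + 2 ^ k)%N by rewrite addnn -mul2n -expnS.
    exact: aK.
  have -> : rho = (1 + d) * z ^+ 2 by rewrite /d; field; lra.
  rewrite exprMn mulrAC ler_pM2r ?exprn_gt0 // -ler_pdivlMr //.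
  apply: le_trans; apply: le_trans (bern _).
  by rewrite lerD2l ler_pM2r // ler_nat.
have := bnd (Num.bound `|K / a 0 / d|).
have : K / a 0 / d < (Num.bound `|K / a 0 / d|)%:R.
  by apply: le_lt_trans (ler_norm _) _; exact: archi_boundP.
by rewrite ltr_pdivrMr //; lra.
Qed.

Section Supersolution.
Variables (I : finType) (R : realFieldType).

(** A supersolution multiplicative along the branches of the tree. *)
Definition weight (r : I -> R) (g : seq I) : R := \prod_(i <- g) r i.

(** Each vertex has one neighbour towards the root.  The hypothesis on beta i
    says that this neighbour costs at most S more than the missing outgoing term
    q i, so that the same constant works at every vertex. *)
Lemma walk_weight (beta r q : I -> R) (S z : R) :
    (forall i, 0 <= r i) -> 0 <= S ->
    (forall i, beta i * r i <= q i) ->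
    (forall i, beta i <= r i * (q i + S)) ->
    \sum_i q i + S <= z ->
  forall g, walk beta (weight r) g <= z * weight r g.
Proof.
move=> r0 S0 brq br qz g.
have w0 h : 0 <= weight r h by apply: prodr_ge0.
have wS i h : weight r (i :: h) = r i * weight r h by rewrite /weight big_cons.
case: g => [|j g].
  rewrite /walk /= {2}/weight big_nil mulr1; apply: le_trans qz.
  rewrite -[X in X <= _]addr0 lerD //; apply: ler_sum => i _.
  by rewrite wS /weight big_nil mulr1.
apply: le_trans (ler_wpM2r (w0 _) qz).
rewrite /walk (bigD1 j) //= eqxx [\sum_i q i](bigD1 j) //= addrAC mulrDl.
apply: lerD.
  by rewrite wS mulrA [_ * r j]mulrC ler_wpM2r.
rewrite mulr_suml; apply: ler_sum => i /negPf ->.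
by rewrite (wS i) mulrA ler_wpM2r.
Qed.

End Supersolution.

(** * L-free contractions in a tracial star-algebra *)
Section TracialStarAlgebra.
Variables (R : realType) (A : algType R) (star : A -> A) (t : A -> R).
Hypothesis starD : forall a b, star (a + b) = star a + star b.
Hypothesis starM : forall a b, star (a * b) = star b * star a.
Hypothesis starK : forall a, star (star a) = a.
Hypothesis starZ : forall (r : R) a, star (r *: a) = r *: star a.
Hypothesis tD : forall a b, t (a + b) = t a + t b.
Hypothesis tZ : forall (r : R) a, t (r *: a) = r * t a.
Hypothesis tC : forall a b, t (a * b) = t (b * a).
Hypothesis t1 : t 1 = 1.
Hypothesis t_ge0 : forall a, 0 <= t (star a * a).

Let star0 : star 0 = 0. Proof. by rewrite -(scale0r 0) starZ !scale0r. Qed.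
Let star1 : star 1 = 1.
Proof. by have := starM 1 (star 1); rewrite starK !mul1r starK. Qed.
Let t0 : t 0 = 0. Proof. by rewrite -(scale0r 0) tZ mul0r. Qed.
Let star_sum (J : Type) (s : seq J) (c : J -> R) (a : J -> A) :
  star (\sum_(p <- s) c p *: a p) = \sum_(p <- s) c p *: star (a p).
Proof.
elim/big_rec2: _ => // p _ y _ <-.
by rewrite starD starZ.
Qed.
Let t_sum (J : Type) (s : seq J) (a : J -> A) :
  t (\sum_(p <- s) a p) = \sum_(p <- s) t (a p).
Proof. by elim/big_rec2: _ => // p _ y _ <-. Qed.

Variables (n : nat) (x : 'I_n -> A).
Local Notation I := 'I_n.

(** The rightmost factor is x, and the factors alternate between x and its
    adjoint; so a factor is an adjoint when an odd number of factors follows. *)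
Fixpoint alt_prod (g : seq I) : A :=
  if g is i :: g' then (if odd (size g') then star (x i) else x i) * alt_prod g'
  else 1.

(** Words of even and odd length give vectors in two orthogonal copies of A,
    exchanged by the self-adjoint 2 x 2 matrices with off-diagonal entries x i
    and star (x i); e tells the copy. *)
Definition side (b : A) (e : bool) (g : seq I) : A :=
  if odd (size g) == e then alt_prod g * b else 0.

Definition gram (b : A) (g h : seq I) : R :=
  t (star (side b true g) * side b true h) +
  t (star (side b false g) * side b false h).

Let letter e i : A := if e then x i else star (x i).

Lemma side_cons b e i g : side b e (i :: g) = letter e i * side b (~~ e) g.
Proof.
rewrite /side /letter /=; case: (odd _) e => [] [] /=; rewrite ?mulr0 ?mulrA //.
Qed.

Lemma star_letter e i : star (letter e i) = letter (~~ e) i.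
Proof. by case: e => //=; rewrite starK. Qed.

Lemma gram_sym b i g h : gram b g (i :: h) = gram b (i :: g) h.
Proof. by rewrite /gram addrC !side_cons !starM !star_letter !mulrA. Qed.

Lemma quad_sum (s : seq (R * seq I)) (a : seq I -> A) :
  \sum_(p <- s) \sum_(q <- s) p.1 * q.1 * t (star (a p.2) * a q.2) =
  t (star (\sum_(p <- s) p.1 *: a p.2) * (\sum_(p <- s) p.1 *: a p.2)).
Proof.
rewrite star_sum mulr_suml t_sum; apply: eq_bigr => p _.
rewrite mulr_sumr t_sum; apply: eq_bigr => q _; rewrite -mulrA.
by apply/esym; rewrite -scalerAl -scalerAr !tZ.
Qed.

Lemma gram_psd b (s : seq (R * seq I)) :
  0 <= \sum_(p <- s) \sum_(q <- s) p.1 * q.1 * gram b p.2 q.2.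
Proof.
have := addr_ge0 (t_ge0 (\sum_(p <- s) p.1 *: side b true p.2))
                 (t_ge0 (\sum_(p <- s) p.1 *: side b false p.2)).
rewrite -!quad_sum -big_split /=; congr (_ <= _); apply: eq_bigr => p _.
by rewrite -big_split /=; apply: eq_bigr => q _; rewrite -mulrDr.
Qed.

(** Positivity is only available as being a square, so contractivity is stated
    by exhibiting a square root of the defect. *)
Hypothesis x_contr : forall i, exists y, star (x i) * x i + star y * y = 1.
Hypothesis xs_contr : forall i, exists y, x i * star (x i) + star y * y = 1.

Lemma letter_contr e i :
  exists y, star (letter e i) * letter e i + star y * y = 1.
Proof. by case: e => /=; rewrite ?starK. Qed.

(** The defect of the letter on each copy is a square, so the double sum is the
    trace of a sum of two squares. *)
Lemma gram_contr b i (s : seq (R * seq I)) :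
  0 <= \sum_(p <- s) \sum_(q <- s)
         p.1 * q.1 * (gram b p.2 q.2 - gram b (i :: p.2) (i :: q.2)).
Proof.
have [u uE] := letter_contr true i; have [v vE] := letter_contr false i.
have diffE e y g h : star (letter e i) * letter e i + star y * y = 1 ->
    t (star (y * side b (~~ e) g) * (y * side b (~~ e) h)) =
    t (star (side b (~~ e) g) * side b (~~ e) h) -
    t (star (side b e (i :: g)) * side b e (i :: h)).
  move=> yE; rewrite !side_cons !starM.
  have {2}<- : 1 * side b (~~ e) h = side b (~~ e) h by rewrite mul1r.
  by rewrite -{1}yE mulrDl mulrDr tD -!mulrA addrC addKr.
have := addr_ge0 (t_ge0 (\sum_(p <- s) p.1 *: (v * side b true p.2)))
                 (t_ge0 (\sum_(p <- s) p.1 *: (u * side b false p.2))).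
rewrite -(quad_sum s (fun g => v * side b true g)).
rewrite -(quad_sum s (fun g => u * side b false g)) -big_split /=.
congr (_ <= _); apply: eq_bigr => p _; rewrite -big_split /=.
apply: eq_bigr => q _.
rewrite -mulrDr (diffE false _ _ _ vE) (diffE true _ _ _ uE) /=.
by rewrite /gram; ring.
Qed.

Hypothesis x_free : forall g : seq I,
  reduced g -> ~~ odd (size g) -> g != [::] -> t (star (alt_prod g)) = 0.

(** By traciality the first column depends on b only through b * star b, and
    linearly: this is what allows to compare the moments at b with those at 1. *)
Lemma gram_nil b g : gram b g [::] =
  if odd (size g) then 0 else t (star (alt_prod g) * (b * star b)).
Proof.
rewrite /gram /side /= mulr0 t0 add0r mul1r.
case: odd => //=; first by rewrite star0 mul0r t0.
by rewrite starM tC mulrA tC.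
Qed.

Variables (beta r q : I -> R) (S z : R).
Hypothesis z_gt0 : 0 < z.
Hypothesis beta_ge0 : forall i, 0 <= beta i.
Hypothesis r_ge0 : forall i, 0 <= r i.
Hypothesis S_ge0 : 0 <= S.
Hypothesis brq : forall i, beta i * r i <= q i.
Hypothesis br : forall i, beta i <= r i * (q i + S).
Hypothesis qz : \sum_i q i + S <= z.

Theorem Lfree_L2_bound b :
    (exists K d, b * star b + d * star d = K *: 1) ->
  t (star ((\sum_i beta i *: x i) * b) * ((\sum_i beta i *: x i) * b))
    <= z ^+ 2 * t (star b * b).
Proof.
case=> K [d bd].
have K0 : 0 <= K.
  rewrite -[K]mulr1 -t1 -tZ -bd tD addr_ge0 //.
    by rewrite -{1}(starK b) t_ge0.
  by rewrite -{1}(starK d) t_ge0.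
have mom c := moment_quadratic (gram_sym c) (@gram_contr c) beta (@gram_psd c).
have grow := @quadratic_growth _ (moment (gram b) beta) K z z_gt0 (mom b).
(* The trivial coefficients give both sides the shape of a combination of two
   functions, to which the linearity of the walk applies. *)
have gE g : reduced g ->
    1 * gram b g [::] + 1 * gram d g [::] <= K * weight r g + 0 * 0.
  move=> rg; have w0 : 0 <= weight r g by apply: prodr_ge0.
  rewrite !mul1r mul0r addr0 !gram_nil; case: ifP => [_|go].
    by rewrite addr0 mulr_ge0.
  rewrite -tD -mulrDr bd -scalerAr mulr1 tZ.
  have [g0|g0] := eqVneq g [::].
    by rewrite g0 /= star1 t1 /weight big_nil.
  by rewrite x_free ?go // mulr0 mulr_ge0.
have bound m : moment (gram b) beta (m + m) <= K * z ^+ (m + m).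
  have dm := moment_even_ge0 (gram_sym d) (@gram_contr d) beta (@gram_psd d) m.
  have : moment (gram b) beta (m + m) + moment (gram d) beta (m + m)
      <= K * iter (m + m) (walk beta) (weight r) [::].
    have := @iter_walk_le _ _ beta (m + m) _ (fun w => K * weight r w + 0 * 0)
      beta_ge0 gE [::] isT.
    rewrite (iter_walk_lin _ _ 1 1) (iter_walk_lin _ _ K 0 _ (fun=> 0)).
    by rewrite !mul1r mul0r addr0.
  have := @iter_walk_supersolution _ _ beta (m + m) z (weight r) beta_ge0
     (ltW z_gt0) (fun g _ => walk_weight r_ge0 S_ge0 brq br qz g) [::] isT.
  rewrite {2}/weight big_nil mulr1 => /(ler_wpM2l K0).
  by move: dm; lra.
have -> : t (star b * b) = moment (gram b) beta 0.
  by rewrite /moment /= gram_nil /= star1 mul1r tC.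
apply: le_trans (grow bound).
apply: le_trans (moment2_ge (gram_sym b) (@gram_contr b) beta).
have pE i : side b true [:: i] = x i * b by rewrite /side /= mulr1.
have := quad_sum [seq (beta i, [:: i]) | i <- index_enum I] (side b true).
rewrite !big_map mulr_suml.
under [in RHS]eq_bigr => i _ do rewrite pE scalerAl.
move=> <-; rewrite le_eqVlt; apply/orP; left; apply/eqP.
apply: eq_bigr => i _; rewrite big_map; apply: eq_bigr => j _ /=.
by rewrite /gram {3 4}/side /= mulr0 t0 addr0.
Qed.
End TracialStarAlgebra.

(** * Real-valued norms and completeness *)
Lemma le_harmonic (R : realType) (K x y : R) :
  (forall n, x <= y + K / n.+2%:R) -> x <= y.
Proof.
move=> h; apply/ler_addgt0Pr => e e0.
pose N := Num.bound (`|K| / e).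
apply: le_trans (h N) _; rewrite lerD2l ler_pdivrMr //.
apply: le_trans (ler_norm _) _; rewrite mulrC -ler_pdivrMr //.
have KN : `|K| / e < N%:R by apply: archi_boundP; rewrite divr_ge0 // ltW.
by apply: le_trans (ltW KN) _; rewrite ler_nat leqW.
Qed.

Section RealNorm.
Variables (R : realType) (H : completeNormedModType R[i]).

(** The norm of H takes its values in R[i]; estimates are carried out in R. *)
Definition rnorm (u : H) : R := complex.Re `|u|.

Lemma rnormE u : `|u| = (rnorm u)%:C%C.
Proof. by rewrite /rnorm RRe_real // normr_real. Qed.

Lemma rnorm_ge0 u : 0 <= rnorm u.
Proof. by rewrite -ler0c -rnormE. Qed.

Lemma rnormD u v : rnorm (u + v) <= rnorm u + rnorm v.
Proof. by rewrite -lecR rmorphD /= -!rnormE ler_normD. Qed.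

Lemma rnormN u : rnorm (- u) = rnorm u.
Proof. by rewrite /rnorm normrN. Qed.

Lemma rnorm_dist u v : rnorm (u - v) = rnorm (v - u).
Proof. by rewrite /rnorm distrC. Qed.

Lemma rnorm0 : rnorm 0 = 0. Proof. by rewrite /rnorm normr0. Qed.

Lemma rnorm_eq0 u : rnorm u = 0 -> u = 0.
Proof. by move=> u0; apply/eqP; rewrite -normr_eq0 rnormE u0. Qed.

Lemma rnormZc (a : R[i]) u : rnorm (a *: u) = complex.Re `|a| * rnorm u.
Proof.
have aE : `|a| = (complex.Re `|a|)%:C%C by rewrite RRe_real // normr_real.
by rewrite {1}/rnorm normrZ aE /= rnormE /= !mul0r subr0.
Qed.

Lemma rnormZ (r : R) u : rnorm (r%:C%C *: u) = `|r| * rnorm u.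
Proof. by rewrite rnormZc normc_def /= expr0n addr0 sqrtr_sqr. Qed.

Lemma rnorm_le_harmonic (K : R) u : (forall n, rnorm u <= K / n.+2%:R) -> u = 0.
Proof.
move=> uK; apply/rnorm_eq0/eqP; rewrite eq_le rnorm_ge0 andbT.
by apply: (@le_harmonic _ K) => n; rewrite add0r.
Qed.

(** The rate K / n.+2 is that of the square root iteration; an explicit rate
    keeps all later limits to elementary estimates. *)
Lemma rnorm_complete (u : nat -> H) (K : R) :
    (forall m n, (n <= m)%N -> rnorm (u m - u n) <= K / n.+2%:R) ->
  exists l, forall n, rnorm (l - u n) <= K / n.+2%:R.
Proof.
move=> uK.
have K0 : 0 <= K.
  by have := le_trans (rnorm_ge0 _) (uK 0 0 (leqnn _)); rewrite pmulr_lge0.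
have Klt (e : R) : 0 < e -> exists N, forall n, (N <= n)%N -> K / n.+2%:R < e.
  move=> e0; exists (Num.bound (K / e)) => n Nn.
  rewrite ltr_pdivrMr // mulrC -ltr_pdivrMr //.
  apply: lt_le_trans (archi_boundP _) _; first by rewrite divr_ge0 // ltW.
  by rewrite ler_nat (leq_trans Nn) // leqW.
have small (e : R[i]) : 0 < e -> exists2 e' : R, 0 < e' & e = e'%:C%C.
  rewrite ltcE /= => /andP[/eqP ei e0]; exists (complex.Re e) => //.
  by case: e ei {e0} => a b /= ->.
have : cvgn u.
  apply/cauchy_cvgP/cauchy_ballP => e /small[e' e'0 ->]; near_simpl.
  have [N NP] := Klt e' e'0.
  exists ([set m | (N <= m)%N], [set m | (N <= m)%N]) => [|[m n] /= [Nm Nn]].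
    by split; exact: nbhs_infty_ge.
  rewrite -ball_normE /= rnormE ltcR.
  wlog mn : m n Nm Nn / (n <= m)%N => [hw|].
    by case: (leqP n m) => [/hw|/ltnW /hw h]; [exact|rewrite rnorm_dist; exact: h].
  exact: le_lt_trans (uK _ _ mn) (NP _ Nn).
case/cvg_ex => l ul; exists l => n.
apply/ler_addgt0Pr => e e0.
have e0C : (0 : R[i]) < e%:C%C by rewrite ltcR.
have [N _ NP] := (@cvgr_dist_lt _ _ _ _ _ _ _ ul _ e0C).
pose m := maxn N n.
have := NP m (leq_maxl _ _); rewrite /= rnormE ltcR => lm.
have := rnormD (l - u m) (u m - u n); rewrite addrA subrK => /le_trans; apply.
by rewrite addrC lerD ?uK ?leq_maxr // ltW.
Qed.

Variable dot : {dot H for Num.conj}.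
Hypothesis dotP : hilbert_dot dot.

Lemma dotDl u v w : dot (u + v) w = dot u w + dot v w. Proof. exact: linearDl. Qed.
Lemma dotDr u v w : dot w (u + v) = dot w u + dot w v. Proof. exact: linearDr. Qed.
Lemma dotZl (a : R[i]) u v : dot (a *: u) v = a * dot u v.
Proof. exact: linearZl_LR. Qed.
Lemma dotC u v : dot u v = (dot v u)^*%C.
Proof. by rewrite hermC /= expr0 mul1r. Qed.
Lemma dotZr (a : R[i]) u v : dot u (a *: v) = a^*%C * dot u v.
Proof. exact: linearZr_LR. Qed.

Lemma ReD (a b : R[i]) : complex.Re (a + b) = complex.Re a + complex.Re b.
Proof. by case: a b => [a1 a2] [b1 b2]. Qed.
Lemma ReZ (r : R) (a : R[i]) : complex.Re (r%:C%C * a) = r * complex.Re a.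
Proof. by case: a => [a1 a2] /=; rewrite mul0r subr0. Qed.

Definition rdot (u v : H) : R := complex.Re (dot u v).

Lemma rdot_norm u : rdot u u = rnorm u ^+ 2.
Proof. by rewrite /rdot -dotP rnormE !expr2 /= mulr0 subr0. Qed.

Lemma rdotDl u v w : rdot (u + v) w = rdot u w + rdot v w.
Proof. by rewrite /rdot dotDl ReD. Qed.
Lemma rdotDr u v w : rdot w (u + v) = rdot w u + rdot w v.
Proof. by rewrite /rdot dotDr ReD. Qed.
Lemma rdotZl (r : R) u w : rdot (r%:C%C *: u) w = r * rdot u w.
Proof. by rewrite /rdot dotZl ReZ. Qed.
Lemma rdotC u v : rdot u v = rdot v u.
Proof. by rewrite /rdot dotC; case: (dot v u). Qed.
Lemma rdotZr (r : R) u w : rdot w (r%:C%C *: u) = r * rdot w u.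
Proof. by rewrite rdotC rdotZl rdotC. Qed.

(** Cauchy-Schwarz, from the square of the norm of |v| u - |u| v. *)
Lemma rdot_le u v : rdot u v <= rnorm u * rnorm v.
Proof.
have [u0|u0] := eqVneq (rnorm u) 0.
  by rewrite u0 mul0r (rnorm_eq0 u0) /rdot linear0l.
have [v0|v0] := eqVneq (rnorm v) 0.
  by rewrite v0 mulr0 (rnorm_eq0 v0) /rdot linear0r.
have st : 0 < rnorm u * rnorm v by rewrite mulr_gt0 // lt_def ?u0 ?v0 rnorm_ge0.
have := sqr_ge0 (rnorm ((rnorm v)%:C%C *: u + (- rnorm u)%:C%C *: v)).
rewrite -rdot_norm !(rdotDl, rdotDr, rdotZl, rdotZr) !rdot_norm (rdotC v u).
set s := rnorm u in st *; set t := rnorm v in st *; set d := rdot u v => h.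
rewrite -(ler_pM2l st); move: h; nra.
Qed.

End RealNorm.

(** * The algebra structure of a von Neumann algebra *)
Section BoundedOperators.
Variables (R : realType) (H : completeNormedModType R[i]).
Implicit Types (T S : H -> H) (K : R).

Definition op_bound T K : Prop := forall u, rnorm (T u) <= K * rnorm u.

Lemma linear_bound_cont T K : linear T -> op_bound T K -> bounded_operator T.
Proof.
move=> linT TK; split=> //.
pose fT : {linear H -> H} := HB.pack T (GRing.isLinear.Build _ _ _ _ T linT).
apply: (@bounded_linear_continuous _ _ _ fT); apply/linear_boundedP.
exists K%:C%C; split; first by rewrite complex_real.
move=> r Kr u; rewrite /= !rnormE.
apply: le_trans (_ : K%:C%C * (rnorm u)%:C%C <= _).
  by rewrite -rmorphM lecR TK.
by apply: ler_wpM2r; [rewrite ler0c rnorm_ge0|exact: ltW].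
Qed.

Lemma bounded_operator_bound T : bounded_operator T ->
  exists2 K, 0 < K & op_bound T K.
Proof.
case=> linT contT.
pose fT : {linear H -> H} := HB.pack T (GRing.isLinear.Build _ _ _ _ T linT).
have /linear_boundedP/pinfty_ex_gt0 [K K0 TK] : bounded_near fT (nbhs 0).
  by apply: continuous_linear_bounded; apply: contT.
move: K0 TK; case: K => a b; rewrite ltcE /= => /andP[/eqP -> a0] TK.
exists a => // u; rewrite -lecR rmorphM /= -!rnormE; exact: TK.
Qed.

Lemma linear0f T : linear T -> T 0 = 0.
Proof. by move=> lT; have := lT (-1) 0 0; rewrite scaler0 addr0 scaleN1r addNr. Qed.

Lemma linearDf T u v : linear T -> T (u + v) = T u + T v.
Proof. by move=> lT; have := lT 1 u v; rewrite !scale1r. Qed.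

Lemma linearZf T (a : R[i]) u : linear T -> T (a *: u) = a *: T u.
Proof. by move=> lT; have := lT a u 0; rewrite (linear0f lT) !addr0. Qed.

End BoundedOperators.

Section Membership.
Variables (R : realType) (H : completeNormedModType R[i]).
Variables (dot : {dot H for Num.conj}) (M : set (H -> H)).
Hypothesis Mv : von_neumann_algebra dot M.

Lemma vn_bounded T : M T -> bounded_operator T.
Proof. by case: Mv => MB _ _; exact: MB. Qed.

Lemma vn_linear T : M T -> linear T. Proof. by case/vn_bounded. Qed.

Lemma vn_commute T S : M T -> commutant M S -> T \o S = S \o T.
Proof. by move=> MT [_ SM]; rewrite SM. Qed.

Lemma vn_bicommutant T : bounded_operator T ->
  (forall S, commutant M S -> T \o S = S \o T) -> M T.
Proof. by case: Mv => _ _ MM TB TS; rewrite -MM. Qed.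

Lemma vn_id : M idfun.
Proof.
apply: vn_bicommutant => [|S _]; last by apply/funext.
by apply: (@linear_bound_cont _ _ _ 1) => // u; rewrite mul1r.
Qed.

Lemma vn_lin (a : R[i]) T S : M T -> M S -> M (a *: T + S).
Proof.
move=> MT MS; apply: vn_bicommutant => [|U MU]; last first.
  have [[lU _] _] := MU; apply/funext => u.
  have /(congr1 (@^~ u)) /= TU := vn_commute MT MU.
  have /(congr1 (@^~ u)) /= SU := vn_commute MS MU.
  by rewrite /= [RHS]lU -TU -SU.
split=> [b u v|].
  rewrite /= !fctE (vn_linear MT) (vn_linear MS) !scalerDr !scalerA [b * a]mulrC.
  by rewrite addrACA.
move=> u; apply: cvgD; last by apply: (vn_bounded MS).2.
by apply: cvgZl_tmp; apply: (vn_bounded MT).2.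
Qed.

Lemma vn_comp T S : M T -> M S -> M (T \o S).
Proof.
move=> MT MS; apply: vn_bicommutant => [|U MU]; last first.
  by rewrite -compA (vn_commute MS MU) compA (vn_commute MT MU) compA.
split=> [b u v|]; first by rewrite /= (vn_linear MS) (vn_linear MT).
move=> u; apply: continuous_comp; first exact: (vn_bounded MS).2.
exact: (vn_bounded MT).2.
Qed.

Lemma vn_adjoint_of T : M T -> adjoint_of dot T (adj dot T).
Proof.
by case: Mv => _ Ma _ /Ma[S _ TS]; rewrite (adjE TS).
Qed.

Lemma vn_adj T : M T -> M (adj dot T).
Proof.
by case: Mv => _ Ma _ /Ma[S MS TS]; rewrite (adjE TS).
Qed.

Lemma vn_zero : M 0.
Proof.
by have := vn_lin (-1) vn_id vn_id; rewrite scaleN1r addNr.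
Qed.

Lemma vn_opp T : M T -> M (- T).
Proof.
move=> MT; rewrite -scaleN1r -[_ *: _]addr0.
by apply: vn_lin => //; exact: vn_zero.
Qed.

Lemma vn_add T S : M T -> M S -> M (T + S).
Proof. by move=> MT MS; rewrite -[T]scale1r; exact: vn_lin. Qed.

Lemma vn_scale (a : R[i]) T : M T -> M (a *: T).
Proof.
by move=> MT; rewrite -[_ *: _]addr0; apply: vn_lin => //; exact: vn_zero.
Qed.

End Membership.

(** The operators of M as a type, in order to compute in a ring.  The field is
    restricted to R because only real scalars occur in the computations; nz
    makes the ring nontrivial. *)
Record vn (R : realType) (H : completeNormedModType R[i])
    (dot : {dot H for Num.conj}) (M : set (H -> H))
    (Mv : von_neumann_algebra dot M) (nz : (idfun : H -> H) <> 0) :=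
  Vn { vop : H -> H; _ : `[< M vop >] }.

Arguments vop {R H dot M Mv nz} _.

HB.instance Definition _ R H dot M Mv nz := [isSub for @vop R H dot M Mv nz].
HB.instance Definition _ R H dot M Mv nz := [Choice of @vn R H dot M Mv nz by <:].

Section VnAlgebra.
Variables (R : realType) (H : completeNormedModType R[i]).
Variables (dot : {dot H for Num.conj}) (M : set (H -> H)).
Variables (Mv : von_neumann_algebra dot M) (nz : (idfun : H -> H) <> 0).
Local Notation A := (vn Mv nz).
Implicit Types a b c : A.

Definition mkvn T (MT : M T) : A := Vn _ _ (asboolT MT).

Lemma vopP a : M (vop a). Proof. by apply/asboolP; case: a. Qed.
Lemma vop_inj : injective (vop : A -> H -> H). Proof. exact: val_inj. Qed.

Definition vn_addr a b : A := mkvn (vn_add Mv (vopP a) (vopP b)).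
Definition vn_oppr a : A := mkvn (vn_opp Mv (vopP a)).
Definition vn_mulr a b : A := mkvn (vn_comp Mv (vopP a) (vopP b)).
Definition vn_scaler (r : R) a : A := mkvn (vn_scale Mv r%:C%C (vopP a)).
Definition star a : A := mkvn (vn_adj Mv (vopP a)).

Let addA : associative vn_addr. Proof. by move=> a b c; apply/vop_inj/addrA. Qed.
Let addC : commutative vn_addr. Proof. by move=> a b; apply/vop_inj/addrC. Qed.
Let add0 : left_id (mkvn (vn_zero Mv)) vn_addr.
Proof. by move=> a; apply/vop_inj/add0r. Qed.
Let addN : left_inverse (mkvn (vn_zero Mv)) vn_oppr vn_addr.
Proof. by move=> a; apply/vop_inj/addNr. Qed.
HB.instance Definition _ := GRing.isZmodule.Build A addA addC add0 addN.

Let mulA : associative vn_mulr. Proof. by move=> a b c; apply/vop_inj. Qed.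
Let mul1 : left_id (mkvn (vn_id Mv)) vn_mulr. Proof. by move=> a; apply/vop_inj. Qed.
Let mulx1 : right_id (mkvn (vn_id Mv)) vn_mulr.
Proof. by move=> a; apply/vop_inj. Qed.
Let mulDl : left_distributive vn_mulr +%R.
Proof. by move=> a b c; apply/vop_inj. Qed.
Let mulDr : right_distributive vn_mulr +%R.
Proof.
move=> a b c; apply/vop_inj/funext => u.
exact: (linearDf _ _ (vn_linear Mv (vopP a))).
Qed.
Let one_neq0 : mkvn (vn_id Mv) != 0.
Proof. by apply/eqP => /(congr1 vop). Qed.
HB.instance Definition _ :=
  GRing.Zmodule_isNzRing.Build A mulA mul1 mulx1 mulDl mulDr one_neq0.

Let scaleA (r s : R) a : vn_scaler r (vn_scaler s a) = vn_scaler (r * s) a.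
Proof. by apply/vop_inj; rewrite /= scalerA -rmorphM. Qed.
Let scale1 : left_id 1 vn_scaler. Proof. by move=> a; apply/vop_inj/scale1r. Qed.
Let scaleDr : right_distributive vn_scaler +%R.
Proof. by move=> r a b; apply/vop_inj/scalerDr. Qed.
Let scaleDl a : {morph vn_scaler^~ a : r s / r + s}.
Proof. by move=> r s; apply/vop_inj; rewrite /= rmorphD scalerDl. Qed.
HB.instance Definition _ :=
  GRing.Zmodule_isLmodule.Build R A scaleA scale1 scaleDr scaleDl.
Let scaleAl (r : R) a b : r *: (a * b) = (r *: a) * b. Proof. exact/vop_inj. Qed.
HB.instance Definition _ := GRing.Lmodule_isLalgebra.Build R A scaleAl.
Let scaleAr (r : R) a b : r *: (a * b) = a * (r *: b).
Proof.
apply/vop_inj/funext => u.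
exact: (esym (linearZf _ _ (vn_linear Mv (vopP a)))).
Qed.
HB.instance Definition _ := GRing.Lalgebra_isAlgebra.Build R A scaleAr.

End VnAlgebra.

Arguments star {R H dot M Mv nz} _.

(** * Norm estimates and norm completeness *)
Section VnNorm.
Variables (R : realType) (H : completeNormedModType R[i]).
Variables (dot : {dot H for Num.conj}) (dotP : hilbert_dot dot).
Variables (M : set (H -> H)).
Variables (Mv : von_neumann_algebra dot M) (nz : (idfun : H -> H) <> 0).
Local Notation A := (vn Mv nz).
Implicit Types (a b c : A) (K : R).

Definition nbound a K := op_bound (vop a) K.

Lemma vopE_lin a : linear (vop a). Proof. exact: (vn_linear Mv (vopP a)). Qed.

Lemma nbound_ex a : exists2 K, 0 < K & nbound a K.
Proof. exact: (bounded_operator_bound (vn_bounded Mv (vopP a))). Qed.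

Lemma nbound_le a K K' : K <= K' -> nbound a K -> nbound a K'.
Proof. by move=> KK' aK u; rewrite (le_trans (aK u)) // ler_wpM2r // rnorm_ge0. Qed.

Lemma nbound0 : nbound 0 0.
Proof. by move=> u; rewrite mul0r rnorm0. Qed.

Lemma nboundD a b K K' : nbound a K -> nbound b K' -> nbound (a + b) (K + K').
Proof.
move=> aK bK u; rewrite mulrDl; apply: le_trans (rnormD _ _) _.
by rewrite lerD.
Qed.

Lemma nboundN a K : nbound a K -> nbound (- a) K.
Proof. by move=> aK u; rewrite [vop _ _]/(- vop a u) rnormN. Qed.

Lemma nboundB a b K K' : nbound a K -> nbound b K' -> nbound (a - b) (K + K').
Proof. by move=> aK bK; apply: nboundD => //; exact: nboundN. Qed.

Lemma nboundZ (r : R) a K : nbound a K -> nbound (r *: a) (`|r| * K).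
Proof.
by move=> aK u; rewrite [vop _ _]/(r%:C%C *: vop a u) rnormZ -mulrA ler_wpM2l.
Qed.

Lemma nboundM a b K K' : 0 <= K ->
  nbound a K -> nbound b K' -> nbound (a * b) (K * K').
Proof.
move=> K0 aK bK u; apply: le_trans (aK _) _.
by rewrite -mulrA ler_wpM2l.
Qed.

Lemma nbound_eq0 a K : (forall n, nbound a (K / n.+2%:R)) -> a = 0.
Proof.
move=> aK; apply/vop_inj/funext => u.
apply: (rnorm_le_harmonic (K := K * rnorm u)) => n.
by rewrite mulrAC; exact: aK.
Qed.

Lemma star_adjoint a : adjoint_of dot (vop a) (vop (star a)).
Proof. exact: (vn_adjoint_of Mv (vopP a)). Qed.

Lemma star_uniq a b : adjoint_of dot (vop a) (vop b) -> star a = b.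
Proof. by move=> /adjE ab; apply/vop_inj. Qed.

Lemma starD a b : star (a + b) = star a + star b.
Proof.
apply: star_uniq => u v; rewrite [vop _ u]/(vop a u + vop b u) dotDl.
by rewrite !star_adjoint -dotDr.
Qed.

Lemma starM a b : star (a * b) = star b * star a.
Proof.
apply: star_uniq => u v.
exact: (etrans (star_adjoint a (vop b u) v) (star_adjoint b u _)).
Qed.

Lemma starK a : star (star a) = a.
Proof.
apply: star_uniq => u v.
by rewrite dotC -star_adjoint -dotC.
Qed.

Lemma starZ (r : R) a : star (r *: a) = r *: star a.
Proof.
apply: star_uniq => u v; rewrite [vop _ u]/(r%:C%C *: vop a u).
rewrite [vop _ v]/(r%:C%C *: vop (star a) v).
by rewrite dotZl dotZr star_adjoint conjc_real.
Qed.

Lemma star1 : star (1 : A) = 1.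
Proof. by apply: star_uniq => u v. Qed.

Lemma starN a : star (- a) = - star a.
Proof. by rewrite -scaleN1r starZ scaleN1r. Qed.

Lemma rdot_star a u v : rdot dot (vop a u) v = rdot dot u (vop (star a) v).
Proof. by rewrite /rdot star_adjoint. Qed.

Lemma nbound_star a K : 0 <= K -> nbound a K -> nbound (star a) K.
Proof.
move=> K0 aK u; set v := vop (star a) u.
have [->|v0] := eqVneq (rnorm v) 0; first by rewrite mulr_ge0 // rnorm_ge0.
have vp : 0 < rnorm v by rewrite lt_def v0 rnorm_ge0.
rewrite -(ler_pM2l vp) -expr2 -(rdot_norm dotP) {1}/v rdotC // -rdot_star.
apply: le_trans (rdot_le dotP _ _) _.
by rewrite mulrA [_ * K]mulrC ler_wpM2r // rnorm_ge0.
Qed.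

(** A norm limit of operators of M commutes with the commutant of M, hence is in
    its bicommutant. *)
Lemma vn_complete (a : nat -> A) K :
    (forall m n, (n <= m)%N -> nbound (a m - a n) (K / n.+2%:R)) ->
  exists l : A, forall n, nbound (l - a n) (K / n.+2%:R).
Proof.
move=> aK.
have lim u : exists l, forall n, rnorm (l - vop (a n) u) <= K * rnorm u / n.+2%:R.
  apply: rnorm_complete => m n nm; rewrite mulrAC; exact: aK.
have [T TP] := choice lim.
have linT : linear T.
  move=> r u v; apply/eqP; rewrite -subr_eq0; apply/eqP.
  pose B :=
    K * rnorm (r *: u + v) + complex.Re `|r| * (K * rnorm u) + K * rnorm v.
  apply: (rnorm_le_harmonic (K := B)) => n.
  have -> : T (r *: u + v) - (r *: T u + T v) =
      (T (r *: u + v) - vop (a n) (r *: u + v)) -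
      (r *: (T u - vop (a n) u)) - (T v - vop (a n) v).
    rewrite vopE_lin scalerBr !opprB opprD opprD !addrA.
    rewrite [RHS](addrAC _ _ (- T v)) (addrAC _ (- vop (a n) v)) subrK.
    by do 2 ! rewrite [in RHS](addrAC _ (- vop (a n) v)); rewrite subrK.
  apply: le_trans (rnormD _ _) _; rewrite rnormN /B mulrDl lerD //.
  apply: le_trans (rnormD _ _) _; rewrite rnormN mulrDl lerD //.
  rewrite rnormZc -mulrA ler_wpM2l //.
  by rewrite -ler0c RRe_real ?normr_real ?normr_ge0.
have [K0 K00 a0] := nbound_ex (a 0).
have boundT : op_bound T (K / 2 + K0).
  move=> u; rewrite -[T u](subrK (vop (a 0) u)); apply: le_trans (rnormD _ _) _.
  rewrite mulrDl lerD //; by rewrite mulrAC; exact: TP.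
have MT : M T.
  apply: (vn_bicommutant Mv) => [|S MS]; first exact: linear_bound_cont boundT.
  have linS : linear S by case: MS => -[].
  have [B B0 SB] := bounded_operator_bound MS.1.
  apply/funext => u; apply/eqP; rewrite -subr_eq0; apply/eqP.
  apply: (rnorm_le_harmonic (K := K * rnorm (S u) + B * (K * rnorm u))) => n.
  have /(congr1 (@^~ u)) /= Sa := vn_commute (vopP (a n)) MS.
  have -> : (T \o S) u - (S \o T) u =
      (T (S u) - vop (a n) (S u)) - S (T u - vop (a n) u).
    rewrite -scaleN1r addrC (linearDf _ _ linS) -(scaleN1r (vop _ u)).
    by rewrite (linearZf _ _ linS) -Sa /= !scaleN1r opprB addrC addrA subrK.
  apply: le_trans (rnormD _ _) _; rewrite rnormN mulrDl lerD //.
  by apply: le_trans (SB _) _; rewrite -mulrA ler_wpM2l // ltW.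
exists (mkvn _ _ MT) => n u; by rewrite mulrAC; exact: TP.
Qed.

End VnNorm.

(** * Square roots *)
Section SquareRoot.
Variables (R : realType) (H : completeNormedModType R[i]).
Variables (dot : {dot H for Num.conj}) (dotP : hilbert_dot dot).
Variables (M : set (H -> H)).
Variables (Mv : von_neumann_algebra dot M) (nz : (idfun : H -> H) <> 0).
Local Notation A := (vn Mv nz).
Implicit Types (a b c : A) (K : R).

(** One minus the n-th iterate of t |-> (1 + t^2) / 2 from 0, i.e. of the square
    root iteration for c = 1, which majorizes all the others. *)
Fixpoint gap (n : nat) : R := if n is m.+1 then gap m - gap m ^+ 2 / 2 else 1.

(** The bound is preserved since d - d^2/2 increases on [0, 1]. *)
Lemma gap_bound n : 0 <= gap n <= 2 / n.+2%:R.
Proof.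
elim: n => [|n /andP[d0 dn]] /=; first by lra.
have d1 : gap n <= 1.
  by apply: le_trans dn _; rewrite ler_pdivrMr // mul1r ler_nat.
have N0 : 0 <= n%:R :> R by [].
apply/andP; split; first by nra.
have e : 2 / n.+2%:R - (2 / n.+2%:R) ^+ 2 / 2 <= 2 / n.+3%:R :> R.
  have -> : n.+2%:R = n%:R + 2 :> R by rewrite -natrD addn2.
  have -> : n.+3%:R = n%:R + 3 :> R by rewrite -natrD addn3.
  rewrite -subr_ge0.
  have -> : 2 / (n%:R + 3) - (2 / (n%:R + 2) - (2 / (n%:R + 2)) ^+ 2 / 2)
      = 2 / ((n%:R + 3) * (n%:R + 2) ^+ 2) :> R.
    by field; rewrite !gt_eqF //; lra.
  by rewrite divr_ge0 // mulr_ge0 ?exprn_ge0 //; lra.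
apply: le_trans e; move: dn; set s := 2 / _ => dn.
have s1 : s <= 1 by rewrite /s ler_pdivrMr // mul1r ler_nat.
by nra.
Qed.

Lemma gap_le m n : (n <= m)%N -> gap m <= gap n.
Proof.
elim: m => [|m IHm]; first by rewrite leqn0 => /eqP ->.
rewrite leq_eqVlt => /predU1P[-> //|]; rewrite ltnS => /IHm /=.
by have := sqr_ge0 (gap m); lra.
Qed.

(** Iteration towards the solution z of z = (c + z^2) / 2, i.e. of
    (1 - z)^2 = 1 - c. *)
Fixpoint root_seq (c : A) n : A :=
  if n is m.+1 then 2^-1 *: (c + root_seq c m * root_seq c m) else 0.

Lemma commrZ (k : R) a b : GRing.comm b a -> GRing.comm b (k *: a).
Proof. by move=> ba; rewrite /GRing.comm -scalerAl -scalerAr ba. Qed.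

(** The increments are bounded in norm by those of the scalar iteration with
    c = 1, namely by the differences of [gap]. *)
Lemma sqrt_one_sub c : star c = c -> nbound c 1 ->
  exists z, [/\ star z = z, nbound z 1, (1 - z) * (1 - z) = 1 - c
             & forall b, GRing.comm b c -> GRing.comm b z].
Proof.
move=> c_sa c1; pose z := root_seq c.
have half (k : R) : 0 <= k -> `|2^-1 : R| * k = k / 2.
  by move=> _; rewrite ger0_norm // mulrC.
have gap01 n : 0 <= gap n <= 1.
  have /andP[-> dn] := gap_bound n; apply: le_trans dn _.
  by rewrite ler_pdivrMr // mul1r ler_nat.
have z_bound n : nbound (z n) (1 - gap n).
  elim: n => [|n IHn] /=; first by rewrite subrr; exact: nbound0.
  have /andP[d0 d1] := gap01 n.
  apply: nbound_le (nboundZ _ (nboundD c1 (nboundM _ IHn IHn))); last by lra.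
  by rewrite half; [lra|nra].
have z_step n : nbound (z n.+1 - z n) (gap n - gap n.+1).
  elim: n => [|n IHn].
    rewrite /z /= mulr0 addr0 subr0.
    by apply: nbound_le (nboundZ _ c1); rewrite half //; lra.
  have -> : z n.+2 - z n.+1 =
      2^-1 *: ((z n.+1 - z n) * z n.+1 + z n * (z n.+1 - z n)).
    rewrite /z /= -/(root_seq c n.+1) -/z -scalerBr; congr (_ *: _).
    by rewrite mulrBl mulrBr addrA subrK opprD addrACA subrr add0r.
  have /andP[d0 d1] := gap01 n; have /andP[e0 e1] := gap01 n.+1.
  have de : 0 <= gap n - gap n.+1 by rewrite subr_ge0 gap_le.
  apply: nbound_le (nboundZ _ (nboundD (nboundM de IHn (z_bound _))
    (nboundM _ (z_bound n) IHn))); last by lra.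
  rewrite half; last by nra.
  by rewrite /=; nra.
have z_cauchy m n : (n <= m)%N -> nbound (z m - z n) (2 / n.+2%:R).
  move=> nm; suff : nbound (z m - z n) (gap n - gap m).
    apply: nbound_le; have /andP[_ dn] := gap_bound n; apply: le_trans dn.
    by have /andP[dm _] := gap_bound m; rewrite gerBl.
  rewrite -(subnK nm) addnC; elim: (m - n)%N => [|k IHk].
    by rewrite addn0 !subrr; exact: nbound0.
  rewrite addnS -[z _ - _](subrKA (z (n + k)%N)).
  by apply: nbound_le (nboundD (z_step _) IHk); lra.
have [l lP] := vn_complete z_cauchy.
have l1 : nbound l 1.
  move=> u; apply: (@le_harmonic _ (2 * rnorm u)) => n.
  rewrite -[l](subrK (z n)).
  apply: le_trans (nboundD (lP n) (z_bound n) u) _.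
  have /andP[d0 d1] := gap01 n.
  have := rnorm_ge0 u; rewrite mulrDl mulrAC addrC => u0.
  by rewrite lerD2r ler_wpM2r //; lra.
have sqB n : l * l - z n * z n = (l - z n) * l + z n * (l - z n).
  by rewrite mulrBl mulrBr addrA subrK.
have quot0 n : 0 <= 2 / n.+2%:R :> R by rewrite divr_ge0.
have l_fix : l - 2^-1 *: (c + l * l) = 0.
  apply: (nbound_eq0 (K := 4)) => n.
  have -> : l - 2^-1 *: (c + l * l) =
      (l - z n.+1) - 2^-1 *: ((l - z n) * l + z n * (l - z n)).
    rewrite -sqB /z /= -/(root_seq c n) -/z scalerBr !scalerDr.
    by rewrite opprB !opprD !addrA subrK.
  have zn1 : nbound (z n) 1.
    by apply: nbound_le (z_bound n); have /andP[] := gap01 n; lra.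
  apply: nbound_le (nboundB (lP n.+1) (nboundZ _
    (nboundD (nboundM (quot0 n) (lP n) l1) (nboundM ler01 zn1 (lP n))))).
  rewrite half; last by rewrite mulr1 mul1r addr_ge0.
  have : 2 / n.+3%:R <= 2 / n.+2%:R :> R.
    by rewrite ler_pM2l // lef_pV2 ?posrE // ler_nat.
  have -> : 4 / n.+2%:R = 2 * (2 / n.+2%:R) :> R.
    by rewrite mulrA; congr (_ / _); ring.
  by move: (2 / n.+2%:R) (2 / n.+3%:R) => x y; lra.
exists l; split => //.
- apply/eqP; rewrite -subr_eq0; apply/eqP.
  have z_sa n : star (z n) = z n.
    elim: n => [|n IHn]; first by rewrite /z /= -(scale0r 0) starZ !scale0r.
    by rewrite /z /= starZ starD starM c_sa -/(z n) IHn.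
  apply: (nbound_eq0 (K := 4)) => n.
  have -> : star l - l = star (l - z n) - (l - z n).
    by rewrite starD starN z_sa opprB addrA subrK.
  apply: nbound_le (nboundB (nbound_star dotP (quot0 n) (lP n)) (lP n)).
  by rewrite -mulrDl -natrD.
- have e : c + l * l = 2 *: l.
    by move/subr0_eq: l_fix => /(congr1 ( *:%R 2)); rewrite scalerA mulfV ?scale1r.
  rewrite mulrBl mul1r mulrBr mulr1 opprB addrA.
  have -> : l * l = 2 *: l - c by rewrite -e addrAC subrr add0r.
  by rewrite scaler_nat mulr2n; rewrite !addrA subrK addrAC addrK.
- move=> b bc; apply/eqP; rewrite -subr_eq0; apply/eqP.
  have bz n : GRing.comm b (z n).
    elim: n => [|n IHn]; first exact: commr0.
    by apply: commrZ; apply: commrD => //; exact: commrM.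
  have [K K0 bK] := nbound_ex b.
  apply: (nbound_eq0 (K := 4 * K)) => n.
  have -> : b * l - l * b = b * (l - z n) - (l - z n) * b.
    by rewrite mulrBr mulrBl bz opprB addrA subrK.
  apply: nbound_le (nboundB (nboundM (ltW K0) bK (lP n))
    (nboundM (quot0 n) (lP n) bK)).
  by rewrite (mulrC K) -mulrDl -mulrDl mulrAC; rewrite -natrD.
Qed.
End SquareRoot.

(** * From the trace to the operator norm *)
Section Trace.
Variables (R : realType) (H : completeNormedModType R[i]).
Variables (dot : {dot H for Num.conj}) (dotP : hilbert_dot dot).
Variables (M : set (H -> H)) (tau : (H -> H) -> R[i]).
Variable (Mv : von_neumann_algebra dot M).
Hypothesis tau_tracial : tracial_state dot M tau.

Lemma tau0 : tau 0 = 0.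
Proof.
have [tl _ _ _] := tau_tracial; have M0 := vn_zero Mv.
have := tl 1 0 0 M0 M0; rewrite scale1r addr0 mul1r => e.
by apply: (addrI (tau 0)); rewrite -e addr0.
Qed.

Lemma tracial_nontrivial : (idfun : H -> H) <> 0.
Proof.
have [_ _ t1 _] := tau_tracial.
by move=> id0; move: t1; rewrite id0 tau0 => /esym/eqP; rewrite oner_eq0.
Qed.

Variable (nz : (idfun : H -> H) <> 0).
Local Notation A := (vn Mv nz).
Implicit Types (a b c : A) (K : R).

Definition trace a : R := complex.Re (tau (vop a)).

Lemma traceD a b : trace (a + b) = trace a + trace b.
Proof.
have [tl _ _ _] := tau_tracial.
by have := tl 1 _ _ (vopP a) (vopP b); rewrite scale1r mul1r /trace -ReD => <-.
Qed.

Lemma tauZ (k : R[i]) T : M T -> tau (k *: T) = k * tau T.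
Proof.
have [tl _ _ _] := tau_tracial => MT.
by have := tl k _ _ MT (vn_zero Mv); rewrite tau0 !addr0.
Qed.

Lemma traceZ (r : R) a : trace (r *: a) = r * trace a.
Proof. by rewrite /trace tauZ ?ReZ //; exact: vopP. Qed.

Lemma traceC a b : trace (a * b) = trace (b * a).
Proof.
have [_ _ _ tC] := tau_tracial.
exact: (congr1 _ (tC _ _ (vopP a) (vopP b))).
Qed.

Lemma trace1 : trace 1 = 1.
Proof. by have [_ _ t1 _] := tau_tracial; exact: (congr1 _ t1). Qed.

Lemma trace_ge0 a : 0 <= trace (star a * a).
Proof.
have [_ tp _ _] := tau_tracial.
have := tp _ (vopP a); rewrite lecE /= => /andP[_ ]; exact.
Qed.

(** Positivity of tau(T^* T) for T = i a + 1, which is real. *)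
Lemma trace_star a : trace (star a) = trace a.
Proof.
have [tl tp t1 _] := tau_tracial.
have Ma := vopP a; have Ms := vopP (star a); have Msa := vopP (star a * a).
have M1 := vn_id Mv.
pose T : H -> H := 'i%C *: vop a + idfun.
pose S : H -> H := (- 'i%C) *: vop (star a) + idfun.
have MT : M T := vn_lin Mv 'i%C Ma M1.
have adjT : adj dot T = S.
  apply: adjE => u v.
  rewrite [T u]/('i%C *: vop a u + u) [S v]/((- 'i%C) *: vop (star a) v + v).
  by rewrite dotDl dotDr dotZl dotZr star_adjoint /= oppr0 opprK.
have := tp _ MT; rewrite adjT.
have -> : S \o T =
    vop (star a * a) + ((- 'i%C) *: vop (star a) + ('i%C *: vop a + idfun)).
  apply/funext => u.
  rewrite [LHS]/(- 'i%C *: vop (star a) ('i%C *: vop a u + u) +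
    ('i%C *: vop a u + u)).
  rewrite vopE_lin scalerDr scalerA mulNr -expr2 sqr_i opprK scale1r.
  exact: (esym (addrA _ _ _)).
rewrite -[vop (star a * a)]scale1r !tl //; last exact: (vn_lin Mv _ Ms MT).
have := tp _ Ma; rewrite -[adj dot (vop a) \o vop a]/(vop (star a * a)).
rewrite mul1r t1 !lecE /trace => /andP[/eqP + _] /andP[/eqP + _].
move: (tau (vop (star a * a))) (tau (vop a)) (tau (vop (star a))).
by case=> [p1 p2] [q1 q2] [s1 s2] /=; lra.
Qed.

Hypothesis tau_faithful : faithful dot M tau.

Lemma trace_faithful a : trace (star a * a) <= 0 -> a = 0.
Proof.
have [_ tp _ _] := tau_tracial => ta.
apply/vop_inj; apply: (tau_faithful (vopP a)).
have := tp _ (vopP a); rewrite lecE => /andP[/eqP /= im0 re0].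
have : complex.Re (tau (adj dot (vop a) \o vop a)) = 0.
  by apply/eqP; rewrite eq_le re0 andbT; exact: ta.
by move: im0; case: (tau _) => p1 p2 /= -> ->.
Qed.

(** Positivity of 1 - a^* a, as a square in M. *)
Lemma one_sub_square a : nbound a 1 ->
  exists y, star y = y /\ star a * a + star y * y = 1.
Proof.
move=> a1; have := @sqrt_one_sub _ _ _ dotP _ _ _ (star a * a).
case=> [||z [zs _ zz _]].
- by rewrite starM starK.
- by have := nboundM ler01 (nbound_star dotP ler01 a1) a1; rewrite mul1r.
- exists (1 - z); have s1 : star (1 - z) = 1 - z by rewrite starD starN star1 zs.
  by rewrite s1 zz addrCA subrr addr0.
Qed.

Lemma bound_one_sub_square a y :
  star y = y -> star a * a + star y * y = 1 -> nbound y 1.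
Proof.
move=> ys ay u; rewrite mul1r -(@ler_sqr _ (rnorm _)) ?nnegrE ?rnorm_ge0 //.
rewrite -!(rdot_norm dotP) rdot_star.
have -> : vop (star y) (vop y u) = u - vop (star a) (vop a u).
  have e : vop (star a) (vop a u) + vop (star y) (vop y u) = u.
    exact: (congr1 (fun c => vop c u) ay).
  by apply: (addrI (vop (star a) (vop a u))); rewrite e addrC subrK.
rewrite -scaleN1r rdotDr // (_ : -1 = (-1)%:C%C); last by rewrite rmorphN.
rewrite rdotZr // -rdot_star.
by rewrite (rdot_norm dotP (vop a u)); have := sqr_ge0 (rnorm (vop a u)); lra.
Qed.

(** Up to a positive factor, let y = z^2 - h^* h and Y = |y|, v = Y - y.  Then
    y v = - Y v, so that the trace inequality at b = v reads tau(v Y v) <= 0.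
    With r a square root of Y, this gives r v = 0 by faithfulness, then Y v = 0,
    v^2 = Y v - y v = 0 and v = 0.  Hence y = Y = r^2 is positive. *)
Lemma nbound_of_trace h z : 0 <= z ->
    (forall b, trace (star (h * b) * (h * b)) <= z ^+ 2 * trace (star b * b)) ->
  nbound h z.
Proof.
move=> z0 hz; pose y : A := z ^+ 2 *: 1 - star h * h.
have ys : star y = y by rewrite starD starN starZ star1 starM starK.
have [K K0 yK] := nbound_ex y.
pose y1 : A := K^-1 *: y.
have y1s : star y1 = y1 by rewrite starZ ys.
have y1b : nbound y1 1.
  have := nboundZ K^-1 yK; rewrite ger0_norm ?invr_ge0 ?ltW // mulVf //.
  by rewrite gt_eqF.
have [w [ws wE]] := one_sub_square y1b.
have wb := bound_one_sub_square ws wE.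
(* Y is the square root of y1^2 = 1 - w^2, and r the square root of Y. *)
have cs : star (star w * w) = star w * w by rewrite starM starK.
have cb : nbound (star w * w) 1.
  by have := nboundM ler01 (nbound_star dotP ler01 wb) wb; rewrite mul1r.
have [z2 [z2s z2b z2E z2c]] := sqrt_one_sub dotP cs cb.
have [z3 [z3s _ z3E _]] := sqrt_one_sub dotP z2s z2b.
pose Y := 1 - z2; pose r := 1 - z3.
have rs : star r = r by rewrite starD starN star1 z3s.
have YY : Y * Y = y1 * y1.
  by rewrite /Y z2E -wE addrK y1s.
have Yy : Y * y1 = y1 * Y.
  suff : GRing.comm y1 Y by move=> ->.
  apply: commrB; first exact: commr1.
  apply: z2c; rewrite -[star w * w](addrK (star y1 * y1)) [X in X - _]addrC wE y1s.
  by apply: commrB; [exact: commr1|exact: commrM].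
(* Twice the negative part of y1. *)
pose v := Y - y1.
have Ys : star Y = Y by rewrite starD starN star1 z2s.
have vs : star v = v by rewrite starD starN Ys y1s.
have y1v : y1 * v = - (Y * v).
  by rewrite /v (mulrBr y1 Y) (mulrBr Y Y) YY Yy opprB.
have rv : r * v = 0.
  apply: trace_faithful.
  have -> : star (r * v) * (r * v) = - (star v * (y1 * v)).
    by rewrite starM rs y1v mulrN opprK -!mulrA (mulrA r r) z3E.
  have -> : star v * (y1 * v) =
      K^-1 *: (z ^+ 2 *: (star v * v) + -1 *: (star (h * v) * (h * v))).
    rewrite /y1 /y scaleN1r -!scalerAl -scalerAr mulrBl mulrBr -scalerAl mul1r.
    by rewrite -scalerAr starM !mulrA.
  rewrite -scaleN1r 2!traceZ traceD !traceZ !mulN1r oppr_le0 mulr_ge0 //.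
    by rewrite invr_ge0 ltW.
  by rewrite subr_ge0.
have Yv : Y * v = 0 by rewrite -[Y]z3E -mulrA rv mulr0.
have v0 : v = 0.
  apply: trace_faithful; rewrite vs {1}/v mulrBl Yv y1v Yv oppr0 subr0.
  by rewrite -(scale0r 0) traceZ mul0r.
have yr : y = K *: (r * r).
  rewrite z3E -/Y -[Y](subrK y1) -/v v0 add0r /y1 scalerA mulfV ?scale1r //.
  by rewrite gt_eqF.
move=> u; rewrite -(@ler_sqr _ (rnorm _)) ?nnegrE ?mulr_ge0 ?rnorm_ge0 //.
have : 0 <= rdot dot u (vop y u).
  rewrite yr [vop _ u]/(K%:C%C *: vop r (vop r u)) rdotZr // -{1}rs -rdot_star.
  by rewrite (rdot_norm dotP) mulr_ge0 ?sqr_ge0 // ltW.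
have -> : vop y u = (z ^+ 2)%:C%C *: u + (-1)%:C%C *: (vop (star h) (vop h u)).
  by rewrite rmorphN scaleN1r.
rewrite rdotDr // !rdotZr // -rdot_star.
rewrite !(rdot_norm dotP) exprMn; lra.
Qed.

End Trace.

(** * The operator norm *)
Section OperatorNorm.
Variables (R : realType) (H : completeNormedModType R[i]).

Lemma op_bound_opnorm (T : H -> H) : bounded_operator T -> op_bound T (opnorm T).
Proof.
move=> bT u; have [linT _] := bT; have [K K0 TK] := bounded_operator_bound bT.
have [u0|u0] := eqVneq (rnorm u) 0.
  by rewrite (rnorm_eq0 u0) (linear0f linT) !rnorm0 mulr0.
have u1 : 0 < rnorm u by rewrite lt_def u0 rnorm_ge0.
pose v := (rnorm u)^-1%:C%C *: u.
have vn : rnorm v = 1 by rewrite rnormZ ger0_norm ?invr_ge0 ?ltW // mulVf.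
have uv : u = (rnorm u)%:C%C *: v.
  by rewrite scalerA -rmorphM mulfV // scale1r.
rewrite {1}uv (linearZf _ _ linT) rnormZ ger0_norm ?(ltW u1) // mulrC.
apply: ler_wpM2r; first exact: rnorm_ge0.
apply: ub_le_sup; last first.
  by exists v => //=; rewrite rnormE vn.
exists K => _ [w /= w1 <-]; apply: le_trans (TK w) _.
by rewrite ler_piMr ?(ltW K0) // -lecR -rnormE.
Qed.

Lemma opnorm_le (T : H -> H) (z : R) : 0 <= z -> op_bound T z -> opnorm T <= z.
Proof.
move=> z0 Tz; apply: ge_sup => [|_ [u /= u1 <-]].
  by exists (complex.Re `|T 0|), 0 => //=; rewrite normr0.
apply: le_trans (Tz u) _.
by rewrite ler_piMr // -lecR -rnormE.
Qed.

End OperatorNorm.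

(** * The constants *)
Section Constants.
Variable R : realType.

(** The smallest q i allowed by the fourth condition, given S = 2s, is
    sqrt(s^2 + beta_i^2) - s.  It is replaced by its linearization in beta_i^2 at
    beta_i^2 = 1/n, which is larger by the inequality between arithmetic and
    geometric means, and whose sum only depends on sum_i beta_i^2.  Optimizing s
    in the case of equal weights beta_i = 1/sqrt n gives
    s = (n - 2) rho and sqrt(s^2 + 1/n) = n rho, with
    rho = 1 / (2 sqrt(n (n - 1))). *)
Lemma optimal_weights (n : nat) (beta : 'I_n -> R) : (2 <= n)%N ->
    (forall i, 0 <= beta i) -> \sum_i beta i ^+ 2 <= 1 ->
  exists r q : 'I_n -> R, exists S : R,
    [/\ forall i, 0 <= r i, 0 <= S,
        forall i, beta i * r i <= q i,
        forall i, beta i <= r i * (q i + S)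
      & \sum_i q i + S <= 2 * Num.sqrt (1 - 1 / n%:R)].
Proof.
move=> n2 b0 bs.
have N2 : 2 <= n%:R :> R by rewrite ler_nat.
pose N : R := n%:R.
have NN : 0 < N * (N - 1) by rewrite mulr_gt0 // /N; lra.
pose w := Num.sqrt (N * (N - 1)).
have w0 : 0 < w by rewrite sqrtr_gt0.
have ww : w ^+ 2 = N * (N - 1) by rewrite sqr_sqrtr // ltW.
have N0 : N != 0 by rewrite gt_eqF // /N; lra.
have wn0 : w != 0 by rewrite gt_eqF.
have zE : 2 * Num.sqrt (1 - 1 / n%:R) = 2 * w / N.
  have -> : 1 - 1 / n%:R = (w / N) ^+ 2.
    by rewrite expr_div_n ww -/N; field.
  rewrite sqrtr_sqr ger0_norm ?divr_ge0 ?ltW //; first by rewrite mulrA.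
  by rewrite /N; lra.
rewrite zE.
pose rho := (2 * w)^-1.
have r0 : 0 < rho by rewrite invr_gt0 mulr_gt0.
pose q i := (beta i ^+ 2 + 4 * rho ^+ 2) / (2 * N * rho).
have Np : 0 < N by rewrite /N; lra.
have q0 i : 0 <= q i.
  apply: divr_ge0.
    by apply: addr_ge0; [exact: sqr_ge0|apply: mulr_ge0 (sqr_ge0 _)].
  by apply: mulr_ge0 (ltW r0); apply: mulr_ge0 (ltW Np).
pose S := 2 * (N - 2) * rho.
have S0 : 0 <= S.
  apply: mulr_ge0 (ltW r0); apply: mulr_ge0 => //.
  by rewrite subr_ge0; exact: N2.
exists (fun i => q i / beta i), q, S; split => //.
- by move=> i; rewrite divr_ge0.
- move=> i; have [->|bi] := eqVneq (beta i) 0; first by rewrite mul0r.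
  by rewrite mulrC divfK.
- move=> i; have [->|bi] := eqVneq (beta i) 0.
    by rewrite invr0 mulr0 mul0r.
  have bp : 0 < beta i by rewrite lt_def bi b0.
  rewrite mulrAC ler_pdivlMr // -expr2 -subr_ge0.
  have -> : q i * (q i + S) - beta i ^+ 2 =
      ((beta i ^+ 2 + (N - 2) ^+ 2 * rho ^+ 2 - N ^+ 2 * rho ^+ 2) /
       (2 * N * rho)) ^+ 2.
    by rewrite /q /S; field; rewrite N0 gt_eqF.
  exact: sqr_ge0.
- rewrite /q -mulr_suml big_split /= sumr_const card_ord.
  have -> : 2 * w / N = (1 + N * (4 * rho ^+ 2)) / (2 * N * rho) + S.
    have -> : 2 * w / N = w / N + (N - 1) / w.
      have -> : (N - 1) / w = w / N.
        by apply/eqP; rewrite eqr_div // -expr2 ww mulrC.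
      by rewrite -mulrDl -mulr2n mulr_natl.
    by rewrite /S /rho; field; rewrite N0 wn0.
  rewrite lerD2r; apply: ler_wpM2r; last by rewrite /N [n%:R * _]mulr_natl lerD2r.
  by rewrite invr_ge0; apply: mulr_ge0 (ltW r0); apply: mulr_ge0 (ltW Np).
Qed.
End Constants.

(** * Alternating products of operators *)
Section AlternatingProducts.
Variables (R : realType) (H : completeNormedModType R[i]).
Variables (dot : {dot H for Num.conj}) (M : set (H -> H)).
Variables (Mv : von_neumann_algebra dot M) (nz : (idfun : H -> H) <> 0).
Local Notation A := (vn Mv nz).
Variables (n : nat) (x : 'I_n -> A).

Lemma alt_prod_comp (i0 : 'I_n) (k : nat) (g : seq 'I_n) : size g = (2 * k)%N ->
  vop (alt_prod star x g) =
  \big[comp/idfun]_(j < k) (adj dot (vop (x (nth i0 g (2 * j)%N))) \o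
                            vop (x (nth i0 g (2 * j).+1))).
Proof.
elim: k g => [|k IHk] g gk; first by rewrite big_ord0; case: g gk.
case: g gk => [|i [|j g]] //=; first by lia.
move=> gk; have {}gk : size g = (2 * k)%N by lia.
rewrite big_ord_recl gk oddM /= compA; congr (_ \o _); rewrite (IHk _ gk).
apply: eq_bigr => l _.
have -> : (0 + l + 1 * bump 0 l)%coq_nat = (2 * l).+1 by rewrite /bump /=; lia.
by [].
Qed.

(** Vanishing traces survive the change of phases of the letters. *)
Lemma alt_prod_scale (u : 'I_n -> R[i]) (y : 'I_n -> A) (g : seq 'I_n) :
    (forall i, vop (y i) = u i *: vop (x i)) ->
  exists c : R[i], vop (alt_prod star y g) = c *: vop (alt_prod star x g).
Proof.
move=> yx; elim: g => [|i g [c cE]]; first by exists 1; rewrite scale1r.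
have ys : vop (star (y i)) = (u i)^*%C *: vop (star (x i)).
  apply: adjE => v w; rewrite yx [(_ *: vop (x i)) v]/(u i *: vop (x i) v).
  rewrite [(_ *: vop (star _)) w]/((u i)^*%C *: vop (star (x i)) w).
  by rewrite dotZl dotZr conjcK star_adjoint.
have comp (a b : A) (k : R[i]) (a' b' : A) :
    vop a = k *: vop a' -> vop b = c *: vop b' ->
    vop (a * b) = (k * c) *: vop (a' * b').
  move=> aE bE; rewrite -[vop (a * b)]/(vop a \o vop b) aE bE; apply/funext => v.
  rewrite [LHS]/(k *: vop a' (c *: vop b' v)).
  rewrite (linearZf _ _ (vopE_lin _)); exact: scalerA.
rewrite /=; case: odd.
  by exists ((u i)^*%C * c); apply: comp.
by exists (u i * c); apply: comp.
Qed.

End AlternatingProducts.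

(** * The norm of a sum of L-free contractions *)
Theorem corollary3p5
  (R : realType) (H : completeNormedModType R[i]) (dot : {dot H for Num.conj})
  (dotP : hilbert_dot dot)
  (M : set (H -> H)) (tau : (H -> H) -> R[i])
  (M_vna : von_neumann_algebra dot M) (M_finite : finite_algebra dot M)
  (tau_tracial : tracial_state dot M tau)
  (tau_faithful : faithful dot M tau) (tau_normal : normal dot M tau)
  (n : nat) (n_ge2 : (2 <= n)%N) (x : 'I_n -> H -> H) (x_inj : injective x)
  (xM : forall i, M (x i)) (x_Lfree : L_free dot tau (range x))
  (x_le1 : forall i, opnorm (x i) <= 1) :
  opnorm (\sum_(i < n) x i) <= 2 * Num.sqrt (n%:R - 1) /\
  forall alpha : 'I_n -> R[i], \sum_(i < n) `|alpha i| ^+ 2 <= 1 ->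
    opnorm (\sum_(i < n) alpha i *: x i) <= 2 * Num.sqrt (1 - 1 / n%:R).
Proof.
have nz := tracial_nontrivial M_vna tau_tracial.
pose A := vn M_vna nz.
pose X i : A := mkvn _ _ (xM i).
have [i0] : exists i0 : 'I_n, True by exists (Ordinal (ltnW n_ge2)).
move=> _.
have x1 i : op_bound (x i) 1.
  move=> u; apply: le_trans (op_bound_opnorm (vn_bounded M_vna (xM i)) u) _.
  by rewrite ler_wpM2r ?rnorm_ge0.
have free g : reduced g -> ~~ odd (size g) -> g != [::] ->
    tau (vop (alt_prod star X g)) = 0.
  move=> rg /even_halfK; set k := (size g)./2; rewrite -mul2n => gk g0.
  rewrite (alt_prod_comp _ i0 (esym gk)).
  have k1 : (1 <= k)%N by case: (k) gk g0 => //; case: (g).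
  have inX l : (l < 2 * k)%N -> range x (x (nth i0 g l)).
    by move=> _; exists (nth i0 g l).
  have neqX l : (l.+1 < 2 * k)%N -> x (nth i0 g l) <> x (nth i0 g l.+1).
    move=> lk /x_inj e; move: rg; rewrite /reduced => /(sortedP i0)/(_ l).
    by rewrite -gk lk e eqxx => /(_ isT).
  by have [_ ->] := x_Lfree k _ k1 inX neqX.
have key (alpha : 'I_n -> R[i]) : \sum_(i < n) `|alpha i| ^+ 2 <= 1 ->
    op_bound (\sum_(i < n) alpha i *: x i) (2 * Num.sqrt (1 - 1 / n%:R)).
  move=> asum.
  pose beta i := complex.Re `|alpha i|.
  have betaE i : `|alpha i| = (beta i)%:C%C by rewrite /beta RRe_real ?normr_real.
  have beta0 i : 0 <= beta i by rewrite -ler0c -betaE.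
  have bsum : \sum_i beta i ^+ 2 <= 1.
    rewrite -lecR rmorph_sum /=; apply: le_trans asum.
    rewrite le_eqVlt; apply/orP; left; apply/eqP; apply: eq_bigr => i _.
    by rewrite betaE rmorphXn.
  (* The phases of the alpha i are moved to the operators. *)
  pose u i := if alpha i == 0 then 1 else alpha i / `|alpha i|.
  have un i : `|u i| = 1.
    rewrite /u; case: eqP => [_|/eqP a0]; first exact: normr1.
    by rewrite normrM normrV ?unitfE ?normr_eq0 // normr_id mulfV ?normr_eq0.
  have ua i : (beta i)%:C%C * u i = alpha i.
    rewrite -betaE /u; case: eqP => [->|/eqP a0]; first by rewrite normr0 mul0r.
    by rewrite mulrC divfK // normr_eq0.
  pose y i : A := mkvn _ _ (vn_scale M_vna (u i) (xM i)).
  have y1 i : nbound (y i) 1.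
    move=> v; apply: le_trans (x1 i v); rewrite [vop _ v]/(u i *: x i v) rnormZc un.
    by rewrite [leLHS](mul1r (rnorm (x i v))).
  have [r [q [S [r0 S0 brq br qz]]]] := optimal_weights n_ge2 beta0 bsum.
  have z0 : 0 < 2 * Num.sqrt (1 - 1 / n%:R) :> R.
    rewrite mulr_gt0 // sqrtr_gt0 subr_gt0 ltr_pdivrMr ?mul1r ?ltr1n //.
    by rewrite ltr0n; exact: ltnW.
  have -> : \sum_(i < n) alpha i *: x i = vop (\sum_i beta i *: y i : A).
    rewrite (big_morph (fun a : A => vop a) (id1 := 0) (op1 := +%R)) //.
    apply: eq_bigr => i _; rewrite -ua -scalerA; exact: erefl.
  apply: (nbound_of_trace dotP tau_tracial tau_faithful (ltW z0)) => b.
  have yc i : exists w, star (y i) * y i + star w * w = 1.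
    by have [w [_ e]] := one_sub_square dotP (y1 i); exists w.
  have ysc i : exists w, y i * star (y i) + star w * w = 1.
    have [w [_ e]] := one_sub_square dotP (nbound_star dotP ler01 (y1 i)).
    by exists w; rewrite -{1}(starK (y i)).
  have yfree g : reduced g -> ~~ odd (size g) -> g != [::] ->
      trace tau (star (alt_prod star y g)) = 0.
    move=> rg eg g0; rewrite (trace_star tau_tracial) /trace.
    have [c ->] := alt_prod_scale g (fun i => erefl : vop (y i) = u i *: vop (X i)).
    by rewrite (tauZ M_vna tau_tracial) ?free ?mulr0 //; exact: vopP.
  have bd : exists K (d : A), b * star b + d * star d = K *: 1.
    have [k k0 bk] := nbound_ex b.
    have b1 : nbound (k^-1 *: star b) 1.
      have := nboundZ k^-1 (nbound_star dotP (ltW k0) bk).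
      by rewrite ger0_norm ?invr_ge0 ?(ltW k0) // mulVf // gt_eqF.
    have [w [ws]] := one_sub_square dotP b1.
    rewrite starZ starK ws -scalerAl -scalerAr scalerA => e.
    exists (k * k), (k *: w); rewrite starZ ws -scalerAl -scalerAr scalerA.
    by rewrite -e scalerDr scalerA -invfM mulfV ?scale1r // mulf_neq0 // gt_eqF.
  exact: (@Lfree_L2_bound R A star (@trace _ _ _ _ tau M_vna nz)
    (starD (nz := nz)) (starM (nz := nz)) (starK (nz := nz)) (starZ (nz := nz))
    (fun a c : A => traceD tau_tracial a c)
    (fun k (a : A) => traceZ tau_tracial k a)
    (fun a c : A => traceC tau_tracial a c) (trace1 M_vna tau_tracial nz)
    (fun a : A => trace_ge0 tau_tracial a)
    n y yc ysc yfree beta r q S _ z0 beta0 r0 S0 brq br qz b bd).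
have N0 : 0 < n%:R :> R by rewrite ltr0n; exact: ltnW.
have n1 : 0 <= n%:R - 1 :> R by rewrite subr_ge0 ler1n; exact: ltnW.
split=> [|alpha /key]; last first.
  by apply: opnorm_le; rewrite mulr_ge0 ?sqrtr_ge0.
apply: opnorm_le; first by rewrite mulr_ge0 ?sqrtr_ge0.
have s0 : 0 < Num.sqrt (n%:R : R) by rewrite sqrtr_gt0.
have ss : Num.sqrt (n%:R : R) ^+ 2 = n%:R by rewrite sqr_sqrtr // ltW.
pose a : R := (Num.sqrt n%:R)^-1.
have -> : \sum_(i < n) x i =
    (Num.sqrt (n%:R : R))%:C%C *: \sum_(i < n) (a%:C%C *: x i).
  rewrite -scaler_sumr scalerA -rmorphM mulfV ?scale1r //.
  by rewrite gt_eqF.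
have -> : 2 * Num.sqrt (n%:R - 1) =
    Num.sqrt n%:R * (2 * Num.sqrt (1 - 1 / n%:R)) :> R.
  rewrite mulrCA -sqrtrM ?(ltW N0) //; congr (_ * Num.sqrt _).
  by rewrite mulrBr mulr1 mul1r mulfV // gt_eqF.
move=> v; rewrite [(_ *: _) v]/((Num.sqrt (n%:R : R))%:C%C *:
  (\sum_(i < n) a%:C%C *: x i) v).
rewrite rnormZ ger0_norm ?(ltW s0) // -mulrA ler_wpM2l ?(ltW s0) //.
apply: key; rewrite sumr_const card_ord.
have -> : `|a%:C%C| ^+ 2 = (n%:R^-1)%:C%C :> R[i].
  rewrite -add_Re2_Im2 /= expr0n addr0 /a exprVn ss //.
by rewrite -rmorphMn -[_ *+ n]mulr_natl mulfV // gt_eqF.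
Qed.
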